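(* Let $k\geq 0$ and let $\Gamma$ be a discrete group that is virtually $\mathbb{Z}^k$. Then for every $n>0$, the space $\overline{\mathrm{Irr}}^+_n(\Gamma)$ is homeomorphic to a CW complex of dimension at most $k$.
   Context: A group is virtually $\mathbb{Z}^k$ if it has a finite index subgroup isomorphic to $\mathbb{Z}^k$. For a finitely generated group $\Gamma$, $\mathrm{Hom}(\Gamma,U(n))$ is the space of homomorphisms with the subspace topology from $U(n)^\Gamma$, and $U(n)$ acts on it by conjugation. A representation $\rho$ is reducible if $\rho\cong\phi\oplus\psi$ (block sum, up to unitary conjugation) with $\phi,\psi$ of positive dimension, and irreducible otherwise. Write $\mathrm{Sum}(\Gamma,U(n))$ and $\mathrm{Irr}(\Gamma,U(n))$ for the subspaces of reducible and irreducible representations, $\overline{\mathrm{Hom}}_n(\Gamma)=\mathrm{Hom}(\Gamma,U(n))/U(n)$, $\overline{\mathrm{Sum}}_n(\Gamma)=\mathrm{Sum}(\Gamma,U(n))/U(n)$, $\overline{\mathrm{Irr}}_n(\Gamma)=\mathrm{Irr}(\Gamma,U(n))/U(n)$. Define $\overline{\mathrm{Irr}}^+_n(\Gamma)=\overline{\mathrm{Hom}}_n(\Gamma)/\overline{\mathrm{Sum}}_n(\Gamma)$ (the reducibles collapsed to a basepoint; a disjoint basepoint is added if there are no reducibles); it is the one-point compactification of $\overline{\mathrm{Irr}}_n(\Gamma)$. *)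

(* Defs.v *)
From HB Require Import structures.
From mathcomp Require Import all_boot all_order all_algebra.
From mathcomp Require Import all_classical all_reals all_analysis.
From mathcomp Require Import complex.
Import numFieldTopology.Exports numFieldNormedType.Exports.
Import Order.TTheory GRing.Theory Num.Theory.

Set Implicit Arguments.
Unset Strict Implicit.
Unset Printing Implicit Defensive.

Local Open Scope classical_set_scope.
Local Open Scope ring_scope.

(* Complex numbers, conjugate transpose, unitary matrices              *)

(* The complex numbers R[i] over a real field R (numClosedFieldType,   *)
(* hence with its usual (norm) topology).                              *)
Definition Cplx (R : realType) : numClosedFieldType := R[i].

(* conjugate transpose A^* *)
Definition ctrmx (R : realType) (n : nat) (A : 'M[Cplx R]_n) : 'M[Cplx R]_n :=
  (map_mx (fun z : Cplx R => z^*) A)^T.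

(* A is in U(n) *)
Definition unitary (R : realType) (n : nat) (A : 'M[Cplx R]_n) : Prop :=
  A *m ctrmx A = 1%:M.

(* Groups: virtually Z^k                                               *)

(* Gamma has a finite index subgroup isomorphic to Z^k: there is an    *)
(* injective homomorphism phi : Z^k -> Gamma (its image is the         *)
(* subgroup H) and finitely many elements s such that every g lies in  *)
(* some left coset x H with x in s.                                    *)
Definition virtually_Zk (G : groupType) (k : nat) : Prop :=
  exists phi : 'rV[int]_k -> G,
    (forall a b, phi (a + b) = (phi a * phi b)%g) /\
    injective phi /\
    exists s : seq G, forall g : G, exists2 x, x \in s & exists a, g = (x * phi a)%g.

(* Representations                                                     *)

(* rho : Gamma -> U(n) is a homomorphism *)
Definition is_rep (R : realType) (G : groupType) (n : nat)
  (rho : G -> 'M[Cplx R]_n) : Prop :=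
  (forall g, unitary (rho g)) /\ (forall g h, rho (g * h)%g = rho g *m rho h).

(* rho ~ sigma up to unitary conjugation *)
Definition conj_equiv (R : realType) (G : groupType) (n : nat)
  (rho sigma : G -> 'M[Cplx R]_n) : Prop :=
  exists U : 'M[Cplx R]_n, unitary U /\ forall g, sigma g = U *m rho g *m ctrmx U.

(* rho is reducible: rho is unitarily conjugate to a block sum phi (+) psi *)
(* of representations of positive dimensions p, q with p + q = n.          *)
Definition reducible (R : realType) (G : groupType) (n : nat)
  (rho : G -> 'M[Cplx R]_n) : Prop :=
  exists (p q : nat) (e : (p + q)%N = n) (U : 'M[Cplx R]_n)
         (phi : G -> 'M[Cplx R]_p) (psi : G -> 'M[Cplx R]_q),
    [/\ (0 < p)%N, (0 < q)%N, is_rep phi, is_rep psi &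
        (unitary U /\ forall g, U *m rho g *m ctrmx U =
                  castmx (e, e) (block_mx (phi g) 0 0 (psi g)))].

(* Hom(Gamma, U(n)) with the subspace topology of U(n)^Gamma, i.e. of the *)
(* product (pointwise) topology on M_n(C)^Gamma.                          *)
Definition hom_set (R : realType) (G : groupType) (n : nat) :
  set {ptws G -> 'M[Cplx R]_n} := [set rho | is_rep rho].

Definition HomSp (R : realType) (G : groupType) (n : nat) : topologicalType :=
  set_type (@hom_set R G n).

(* General constructions: quotient by a relation, disjoint basepoint   *)

(* The space of classes [x] = r x, with the quotient topology: a set of *)
(* classes is open iff its preimage under x |-> [x] is open.            *)
Definition quot_by (T : topologicalType) (r : T -> T -> Prop) : Type :=
  {A : set T | `[< exists x, A = r x >]}.

HB.instance Definition _ (T : topologicalType) (r : T -> T -> Prop) :=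
  Choice.on (quot_by r).

Definition qpi (T : topologicalType) (r : T -> T -> Prop) (x : T) : quot_by r :=
  exist _ (r x) (introT (asboolP _) (ex_intro _ x erefl)).

Section QuotTop.
Context (T : topologicalType) (r : T -> T -> Prop).
Definition quot_open (U : set (quot_by r)) : Prop := open (qpi r @^-1` U).
Lemma quot_openT : quot_open setT.
Proof. by rewrite /quot_open preimage_setT; exact: openT. Qed.
Lemma quot_openI : setI_closed quot_open.
Proof. by move=> A B oA oB; rewrite /quot_open preimage_setI; exact: openI. Qed.
Lemma quot_open_bigU (I : Type) (f : I -> set (quot_by r)) :
  (forall i, quot_open (f i)) -> quot_open (\bigcup_i f i).
Proof.
move=> hf; rewrite /quot_open preimage_bigcup.
by apply: bigcup_open => i _; exact: hf.
Qed.
HB.instance Definition _ :=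
  isOpenTopological.Build (quot_by r) quot_openT quot_openI quot_open_bigU.
End QuotTop.

(* a one-point space *)
Definition pt_space : topologicalType := discrete_topology unit.

(* T with a disjoint basepoint added: T (+) {*} *)
Definition plus_pt_fam (T : topologicalType) (b : bool) : topologicalType :=
  if b then T else pt_space.
Definition plus_pt (T : topologicalType) : topologicalType :=
  {b : bool & plus_pt_fam T b}.

Definition pp_proj (T : topologicalType) (x : plus_pt T) : option T :=
  match x with
  | existT b v =>
      (if b as b' return plus_pt_fam T b' -> option T
       then fun v => Some v else fun _ => None) v
  end.

(* Irr^+_n(Gamma)                                                       *)

(* points of Hom(Gamma,U(n)) (+) {*} that are collapsed to the basepoint: *)
(* the added point and the reducible representations.                     *)
Definition collapsed (R : realType) (G : groupType) (n : nat)
  (x : plus_pt (HomSp R G n)) : Prop :=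
  match pp_proj x with
  | Some rho => reducible (val rho : G -> 'M[Cplx R]_n)
  | None => True
  end.

(* x ~ y iff both are collapsed, or they are U(n)-conjugate representations *)
Definition irr_rel (R : realType) (G : groupType) (n : nat)
  (x y : plus_pt (HomSp R G n)) : Prop :=
  (collapsed x /\ collapsed y) \/
  exists rho sigma : HomSp R G n,
    [/\ pp_proj x = Some rho, pp_proj y = Some sigma &
        conj_equiv (val rho : G -> 'M[Cplx R]_n) (val sigma)].

(* Irr^+_n(Gamma) = (Hom(Gamma,U(n)) (+) {*}) / ~ , i.e. Hom/U(n) with the *)
(* reducibles (and the extra point) collapsed to one basepoint.            *)
Definition IrrPlus (R : realType) (G : groupType) (n : nat) : topologicalType :=
  quot_by (@irr_rel R G n).

(* Homeomorphisms and finite-dimensional CW complexes                  *)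

Definition homeomorphic (X Y : topologicalType) : Prop :=
  exists (f : X -> Y) (g : Y -> X),
    [/\ continuous f, continuous g, cancel f g & cancel g f].

Definition sqnorm (R : realType) (m : nat) (v : 'rV[R]_m) : R :=
  \sum_(i < m) (v ord0 i) ^+ 2.
(* closed unit disk D^m, open disk, boundary sphere S^{m-1} in R^m *)
Definition cdisk (R : realType) (m : nat) : set 'rV[R]_m := [set v | sqnorm v <= 1].
Definition odisk (R : realType) (m : nat) : set 'rV[R]_m := [set v | sqnorm v < 1].
Definition bsphere (R : realType) (m : nat) : set 'rV[R]_m := [set v | sqnorm v = 1].

(* X admits a CW structure all of whose cells have dimension <= d:       *)
(* cells indexed by I, with characteristic maps Phi i : D^(dim i) -> X   *)
(* such that X is Hausdorff, the open cells e_i = Phi i (int D) partition *)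
(* X, Phi i restricts to a homeomorphism int D -> e_i, Phi i maps the     *)
(* boundary sphere into cells of lower dimension, each closed cell meets  *)
(* finitely many open cells (closure finiteness), and X carries the weak  *)
(* topology (A is closed as soon as every Phi_i^{-1}(A) is closed in D).  *)
Definition CW_dim_le (R : realType) (X : topologicalType) (d : nat) : Prop :=
  exists (I : Type) (dim : I -> nat) (Phi : forall i, 'rV[R]_(dim i) -> X),
    let cell i := Phi i @` @odisk R (dim i) in
    hausdorff_space X /\
    (forall i, (dim i <= d)%N) /\
    (forall i, {within @cdisk R (dim i), continuous (Phi i)}) /\
    (forall x : X, exists i, cell i x) /\
    (forall i j x, cell i x -> cell j x -> i = j) /\
    (forall i, {in @odisk R (dim i) &, injective (Phi i)}) /\
    (forall i (V : set 'rV[R]_(dim i)), open V ->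
       exists W : set X, open W /\ Phi i @` (V `&` @odisk R (dim i)) = W `&` cell i) /\
    (forall i v, @bsphere R (dim i) v ->
       exists j, (dim j < dim i)%N /\ cell j (Phi i v)) /\
    (forall i, finite_set [set j | (Phi i @` @cdisk R (dim i)) `&` cell j !=set0]) /\
    (forall A : set X,
       (forall i, closed (@cdisk R (dim i) `&` Phi i @^-1` A)) -> closed A).

(* Main.v *)
Require Import Defs.
From HB Require Import structures.
From mathcomp Require Import all_boot all_order all_algebra.
From mathcomp Require Import all_classical all_reals all_analysis.
From mathcomp Require Import complex.
From mathcomp Require Import ring lra.
Import numFieldTopology.Exports numFieldNormedType.Exports.
Import Order.TTheory GRing.Theory Num.Theory.

Set Implicit Arguments.
Unset Strict Implicit.
Unset Printing Implicit Defensive.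

Local Open Scope classical_set_scope.
Local Open Scope ring_scope.

(* Let A be the core of Z^k: a normal abelian subgroup of finite index. The
   characters of A are the points of R^k modulo a lattice, and G acts on them
   through a finite linear group. Finitely many integral linear forms on R^k,
   permuted by G, cut R^k into bounded polytopal cells ("walls" are the sets
   where one of these forms takes an integer value) so that the stabilizers are
   constant on each cell and a motion preserving a cell fixes it pointwise.

   The restriction to A of an irreducible representation rho is a sum of
   characters forming one G-orbit. If x is one of them and v is a direction
   parallel to the cell of x, a transfer cocycle twists rho into a representation
   rho_v over x + v, continuously in v. Twisting preserves intertwiners as
   long as x + v stays in the cell, so the irreducible representations over
   a cell form a trivial finite covering of it; this family extends
   continuously to the closed polytope, whose boundary points lie in
   cells of smaller dimension or become reducible. The finitely many families
   (up to G) and the basepoint are the cells of a CW structure. *)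

(** * Unitary representations *)

(** The obstacle is that a character of [A] need not extend to [G], so an irreducible representation
    cannot be moved by tensoring with a one-dimensional one. The twist therefore multiplies
    different coordinates by different phases, and it is multiplicative only if every coincidence
    [g x = h x] of characters persists along the displacement, that is [g v = h v]. Such a
    coincidence makes the forms [s^g (s^h)^-1] integral at [x], which is why the walls are all the
    differences of a conjugation-stable set. The same differences compare fractional parts in the
    rigidity argument. Multiplicativity only asks [v] to be parallel to the cell, whereas keeping
    irreducibility asks [x + v] to remain in it. Hence each family is defined on the closed polytope
    and can degenerate only on its boundary. On the topological side, Hom is compact, and the
    quotient is Hausdorff because conjugation saturations and the reducible locus are closed. With
    finitely many cells, compactness then gives the weak topology. *)

Lemma mulmx_diag_block (K : pzRingType) p q (A A' : 'M[K]_p) (D D' : 'M[K]_q) :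
  block_mx A 0 0 D *m block_mx A' 0 0 D' = block_mx (A *m A') 0 0 (D *m D').
Proof. by rewrite mulmx_block !mulmx0 !mul0mx !addr0 add0r. Qed.

Lemma unitary_basis_of_subspace (C : numClosedFieldType) n (W : 'M[C]_n) :
  exists p q (e : (p + q)%N = n) (A : 'M[C]_(p, n)) (B : 'M[C]_(q, n)),
  [/\ p = \rank W, col_mx A B \is unitarymx, (A :=: W)%MS &
      A *m map_mx Num.conj B^T = 0].
Proof.
pose V := orthomx Num.conj (mx_of_hermitian (hermitian1mx n)) W.
exists (\rank W), (\rank V), (add_rank_ortho W).
exists (schmidt (row_base W)), (schmidt (row_base V)).
have uU := schmidt_complete_unitarymx W.
have WE : (schmidt (row_base W) :=: W)%MS.
  apply: eqmx_trans (eq_row_base W).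
  exact: eqmx_schmidt_free (row_base_free W).
split => //.
move/unitarymxP: uU; rewrite tr_col_mx map_row_mx mul_col_row scalar_mx_block.
by move=> /eq_block_mx[].
Qed.

Section Unitary.
Variables (R : realType) (n : nat).
Implicit Types A B U T : 'M[Cplx R]_n.

Lemma ctrmxE A : ctrmx A = map_mx (@Num.conj (Cplx R)) A^T.
Proof. by rewrite /ctrmx map_trmx. Qed.

Lemma unitaryP A : unitary A <-> A \is unitarymx.
Proof. by rewrite /unitary ctrmxE; split=> /unitarymxP. Qed.

Lemma ctrmxM A B : ctrmx (A *m B) = ctrmx B *m ctrmx A.
Proof. by rewrite !ctrmxE trmx_mul map_mxM. Qed.

Lemma ctrmxK A : ctrmx (ctrmx A) = A.
Proof. by apply/matrixP => i j; rewrite !mxE conjCK. Qed.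

Lemma ctrmx1 : ctrmx (1%:M : 'M[Cplx R]_n) = 1%:M.
Proof. by rewrite ctrmxE trmx1 map_mx1. Qed.

Lemma unitary_mulV U : unitary U -> ctrmx U *m U = 1%:M.
Proof. exact: mulmx1C. Qed.

Lemma unitary1 : unitary (1%:M : 'M[Cplx R]_n).
Proof. by rewrite /unitary ctrmx1 mulmx1. Qed.

Lemma unitaryM A B : unitary A -> unitary B -> unitary (A *m B).
Proof. by rewrite !unitaryP; exact: mul_unitarymx. Qed.

Lemma unitaryV A : unitary A -> unitary (ctrmx A).
Proof. by move=> uA; rewrite /unitary ctrmxK unitary_mulV. Qed.

Lemma unitary_norm_le1 U i j : unitary U -> `|U i j| <= 1.
Proof.
move=> /matrixP/(_ i i); rewrite !mxE eqxx => h.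
rewrite -(@ler_sqr _ `|U i j|) ?nnegrE// expr1n.
rewrite -[leRHS]h (bigD1 j)//= !mxE -normCK lerDl sumr_ge0// => l _.
by rewrite !mxE -normCK exprn_ge0.
Qed.

End Unitary.

(** * Schur's lemma and reducibility in terms of the commutant *)

Section Representations.
Variables (R : realType) (G : groupType).

Definition intertwines n (rho sigma : G -> 'M[Cplx R]_n) (T : 'M[Cplx R]_n) :=
  forall g, T *m rho g = sigma g *m T.

Lemma rep1 n (rho : G -> 'M[Cplx R]_n) : is_rep rho -> rho 1%g = 1%:M.
Proof.
move=> [uG mG]; have := mG 1%g 1%g; rewrite mulg1 => /(congr1 (mulmx (ctrmx (rho 1%g)))).
by rewrite mulmxA unitary_mulV// mul1mx => ->.
Qed.

Lemma repV n (rho : G -> 'M[Cplx R]_n) g : is_rep rho -> rho g^-1%g = ctrmx (rho g).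
Proof.
move=> h; have [uG mG] := h.
rewrite -[LHS]mulmx1 -(uG g) mulmxA -mG mulVg rep1// mul1mx//.
Qed.

Lemma intertwines_ctr n (rho sigma : G -> 'M[Cplx R]_n) T :
  is_rep rho -> is_rep sigma -> intertwines rho sigma T ->
  intertwines sigma rho (ctrmx T).
Proof.
move=> hr hs hT g; have := congr1 (@ctrmx R n) (hT g^-1%g).
by rewrite !ctrmxM !repV// !ctrmxK => ->.
Qed.

Lemma intertwinesM n (rho sigma tau : G -> 'M[Cplx R]_n) S T :
  intertwines rho sigma T -> intertwines sigma tau S ->
  intertwines rho tau (S *m T).
Proof. by move=> hT hS g; rewrite -mulmxA hT mulmxA hS mulmxA. Qed.

Lemma conj_equivP n (rho sigma : G -> 'M[Cplx R]_n) :
  conj_equiv rho sigma <-> exists2 U, unitary U & intertwines rho sigma U.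
Proof.
split=> -[U].
  by move=> [uU hU]; exists U => // g; rewrite hU -mulmxA (unitary_mulV uU) mulmx1.
by move=> uU hU; exists U; split=> // g; rewrite hU -mulmxA uU mulmx1.
Qed.

Lemma conj_equiv_refl n (rho : G -> 'M[Cplx R]_n) : conj_equiv rho rho.
Proof.
by apply/conj_equivP; exists 1%:M; [exact: unitary1|move=> g; rewrite mulmx1 mul1mx].
Qed.

Lemma conj_equiv_sym n (rho sigma : G -> 'M[Cplx R]_n) :
  conj_equiv rho sigma -> conj_equiv sigma rho.
Proof.
move=> [U [uU hU]]; exists (ctrmx U); split; first exact: unitaryV.
move=> g; rewrite ctrmxK hU !mulmxA (unitary_mulV uU) mul1mx -mulmxA.
by rewrite (unitary_mulV uU) mulmx1.
Qed.

Lemma conj_equiv_trans n (rho sigma tau : G -> 'M[Cplx R]_n) :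
  conj_equiv rho sigma -> conj_equiv sigma tau -> conj_equiv rho tau.
Proof.
move=> [U [uU hU]] [V [uV hV]]; exists (V *m U); split; first exact: unitaryM.
by move=> g; rewrite hV hU ctrmxM !mulmxA.
Qed.

Lemma conj_rep n (rho sigma : G -> 'M[Cplx R]_n) :
  conj_equiv rho sigma -> is_rep rho -> is_rep sigma.
Proof.
move=> [U [uU hU]] [ur mr]; split=> [g|g h]; rewrite !hU.
  by apply: unitaryM; [exact: unitaryM|exact: unitaryV].
by rewrite mr -!mulmxA (mulmxA (ctrmx U)) (unitary_mulV uU) mul1mx.
Qed.

Lemma reducible_conj n (rho sigma : G -> 'M[Cplx R]_n) :
  conj_equiv rho sigma -> reducible rho -> reducible sigma.
Proof.
move=> [V [uV hV]] [p [q [e [U [phi [psi [p0 q0 rphi rpsi [uU hU]]]]]]]].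
exists p, q, e, (U *m ctrmx V), phi, psi; split=> //; split.
  by apply: unitaryM => //; exact: unitaryV.
move=> g; have eV : ctrmx V *m (V *m rho g *m ctrmx V) *m V = rho g.
  by rewrite !mulmxA (unitary_mulV uV) mul1mx -mulmxA (unitary_mulV uV) mulmx1.
by rewrite -hU hV ctrmxM ctrmxK -[in RHS]eV !mulmxA.
Qed.

Lemma block_reducible p q (rho : G -> 'M[Cplx R]_(p + q)) U :
  (0 < p)%N -> (0 < q)%N -> is_rep rho -> unitary U ->
  (forall g, ursubmx (U *m rho g *m ctrmx U) = 0) ->
  (forall g, dlsubmx (U *m rho g *m ctrmx U) = 0) -> reducible rho.
Proof.
move=> p0 q0 hr uU hur hdl.
have [s sE] : exists s, s = fun g => U *m rho g *m ctrmx U.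
  by exists (fun g => U *m rho g *m ctrmx U).
have rs : is_rep s by rewrite sE; apply: conj_rep hr; exists U.
have [phi phiE] : exists phi, phi = fun g => ulsubmx (s g) by exists (fun g => ulsubmx (s g)).
have [psi psiE] : exists psi, psi = fun g => drsubmx (s g) by exists (fun g => drsubmx (s g)).
have bs g : s g = block_mx (phi g) 0 0 (psi g).
  by rewrite -[LHS]submxK phiE psiE sE hur hdl.
have [us ms] := rs.
have hb g h : phi (g * h)%g = phi g *m phi h /\ psi (g * h)%g = psi g *m psi h.
  by move: (ms g h); rewrite !bs mulmx_diag_block => /eq_block_mx[-> _ _ ->].
have hu g : unitary (phi g) /\ unitary (psi g).
  move: (us g); rewrite /unitary !ctrmxE bs tr_block_mx map_block_mx.
  rewrite !trmx0 !map_mx0 mulmx_diag_block (@scalar_mx_block _ p q).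
  by move=> /eq_block_mx[-> _ _ ->].
exists p, q, erefl, U, phi, psi; split=> //.
- by split=> [g|g h]; [have [] := hu g|have [] := hb g h].
- by split=> [g|g h]; [have [] := hu g|have [] := hb g h].
- by split=> // g; rewrite castmx_id -bs sE.
Qed.

Lemma stable_reducible n (rho : G -> 'M[Cplx R]_n) (W : 'M[Cplx R]_n) :
  is_rep rho -> (0 < \rank W)%N -> (\rank W < n)%N ->
  (forall g, stablemx W (rho g)) -> reducible rho.
Proof.
move=> hr W0 Wn hW.
have [p [q [e [A [B [pE uAB AW AB]]]]]] := unitary_basis_of_subspace W.
have q0 : (0 < q)%N by rewrite -(ltn_add2l p) addn0 e pE.
have p0 : (0 < p)%N by rewrite pE.
have hur g : A *m rho g *m map_mx Num.conj B^T = 0.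
  have /submxP[D ->] : (A *m rho g <= A)%MS by rewrite (eqmxMr _ AW) AW; exact: hW.
  by rewrite -mulmxA AB mulmx0.
(* The orthogonal complement is stable as well: this is the adjoint of [hur] at [g^-1], since
   [rho g^-1] is the adjoint of [rho g]. *)
have hdl g : B *m rho g *m map_mx Num.conj A^T = 0.
  have := congr1 (fun M => map_mx (@Num.conj (Cplx R)) M^T) (hur g^-1%g).
  rewrite repV// ctrmxE !trmx_mul !map_mxM trmx0 map_mx0 => <-; rewrite mulmxA.
  by congr (_ *m _ *m _); apply/matrixP => i j; rewrite !mxE /= ?conjCK.
clear W W0 Wn hW pE AW AB.
case: n / e rho hr A B uAB hur hdl => rho hr A B uAB hur hdl.
apply: (@block_reducible p q rho (col_mx A B)) => //; first exact/unitaryP.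
  move=> g; rewrite ctrmxE mul_col_mx tr_col_mx map_row_mx mul_col_row block_mxKur.
  exact: hur.
move=> g; rewrite ctrmxE mul_col_mx tr_col_mx map_row_mx mul_col_row block_mxKdl.
exact: hdl.
Qed.

(** The projection onto one block commutes with [rho]; conversely an eigenspace of a non-scalar [T]
    is a proper invariant subspace. Reducibility thus becomes a linear condition on [T], the form
    used both for closedness of the reducible locus and for deformations. *)
Lemma reducibleP n (rho : G -> 'M[Cplx R]_n) : is_rep rho ->
  reducible rho <-> exists2 T, intertwines rho rho T & ~~ is_scalar_mx T.
Proof.
move=> hr; split.
  move=> [p [q [e [U [phi [psi [p0 q0 rphi rpsi [uU hU]]]]]]]].
  case: _ / e rho hr U uU hU => rho hr U uU hU.
  pose P : 'M[Cplx R]_(p + q) := block_mx 1%:M 0 0 0.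
  have hP g : P *m (U *m rho g *m ctrmx U) = (U *m rho g *m ctrmx U) *m P.
    by rewrite hU castmx_id !mulmx_diag_block !mulmx1 !mul1mx mulmx0 mul0mx.
  exists (ctrmx U *m P *m U).
    move=> g; have := congr1 (fun M => ctrmx U *m M *m U) (hP g).
    rewrite !mulmxA (unitary_mulV uU) mul1mx => <-.
    by rewrite -!mulmxA (unitary_mulV uU) mulmx1.
  apply/negP => /is_scalar_mxP[a ha].
  have : P = a%:M.
    have := congr1 (fun M => U *m M *m ctrmx U) ha.
    by rewrite !mulmxA uU mul1mx -!mulmxA uU mulmx1 -scalar_mxC mulmxA uU mul1mx.
  move=> /matrixP h; have i0 : 'I_p := Ordinal p0; have j0 : 'I_q := Ordinal q0.
  have := h (lshift q i0) (lshift q i0); rewrite /P block_mxEul !mxE !eqxx => e1.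
  have := h (rshift p j0) (rshift p j0); rewrite /P block_mxEdr !mxE !eqxx => e2.
  by move: e1; rewrite -e2 => /eqP; rewrite oner_eq0.
move=> [T hT nT].
have n0 : (0 < n)%N.
  case: n rho hr T hT nT => // rho hr T hT /negP[].
  by apply/is_scalar_mxP; exists 0; apply/matrixP => -[].
have [a ha] := eigenvalue_closed T n0.
apply: (@stable_reducible n rho (eigenspace T a)) => //.
- by rewrite lt0n mxrank_eq0.
- rewrite ltnNge; apply/negP => hn; case/negP: nT.
  have /eigenspaceP : (1%:M <= eigenspace T a)%MS.
    by rewrite sub1mx row_full_unit -row_free_unit -row_leq_rank.
  by rewrite mul1mx => ->; rewrite scalemx1 scalar_mx_is_scalar.
- by move=> g; apply: comm_mx_stable_eigenspace; exact: hT.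
Qed.

Lemma schur n (rho : G -> 'M[Cplx R]_n) T : is_rep rho -> ~ reducible rho ->
  intertwines rho rho T -> exists a, T = a%:M.
Proof.
move=> hr nr hT; apply/is_scalar_mxP; apply/negP => /negP h.
by apply: nr; apply/reducibleP => //; exists T.
Qed.

(** By Schur, [T] times its adjoint is a scalar [a], positive because [T] is nonzero; dividing [T]
    by the square root of [a] makes it unitary. *)
Lemma intertwiner_conj n (rho sigma : G -> 'M[Cplx R]_n) T :
  is_rep rho -> is_rep sigma -> ~ reducible sigma ->
  intertwines rho sigma T -> T != 0 -> conj_equiv rho sigma.
Proof.
move=> hr hs ns hT T0.
have hTT := intertwinesM (intertwines_ctr hr hs hT) hT.
have [a ha] := schur hs ns hTT.
have [i [j Tij]] : exists i j, T i j != 0.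
  apply: contrapT => h; move/negP: T0; apply; apply/eqP/matrixP => i j; rewrite mxE.
  by apply/eqP/negPn/negP => hij; apply: h; exists i, j.
have a_gt0 : 0 < a.
  have := congr1 (fun M : 'M[Cplx R]_n => M i i) ha; rewrite !mxE eqxx mulr1n => <-.
  rewrite (bigD1 j)//= !mxE -normCK ltr_wpDr//.
    by rewrite sumr_ge0// => l _; rewrite !mxE -normCK exprn_ge0.
  by rewrite exprn_gt0// normr_gt0.
apply/conj_equivP; exists ((sqrtC a)^-1 *: T); last first.
  by move=> g; rewrite -scalemxAl -scalemxAr hT.
have sa : sqrtC a != 0 by rewrite sqrtC_eq0 gt_eqF.
have sar : Num.conj (sqrtC a)^-1 = (sqrtC a)^-1.
  by apply: CrealP; rewrite realE invr_ge0 sqrtC_ge0 ltW.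
rewrite /unitary.
have -> : ctrmx ((sqrtC a)^-1 *: T) = (sqrtC a)^-1 *: ctrmx T.
  by apply/matrixP => x y; rewrite !mxE rmorphM/= sar.
rewrite -scalemxAl -scalemxAr ha scalerA scale_scalar_mx -invfM -expr2 sqrtCK.
by rewrite mulVf// gt_eqF.
Qed.

End Representations.

(** * The circle *)

Lemma continuous_addrM (K : numFieldType) (T : topologicalType) (c : K)
    (f g : T -> K) (x : T) :
  {for x, continuous f} -> {for x, continuous g} ->
  {for x, continuous (fun t => f t + c * g t)}.
Proof. by move=> cf cg; apply: cvgD => //; apply: cvgM => //; exact: cvg_cst. Qed.

Section ComplexPlane.
Variable R : realType.

Definition cplx (x y : R) : Cplx R := (x +i* y)%C.

Lemma cplxE x y : cplx x y = cplx x 0 + cplx 0 1 * cplx y 0.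
Proof. by rewrite /cplx; simpc; rewrite ?(mulr0, mul0r, mul1r, addr0, add0r, subr0). Qed.

Lemma realcplx_dist_lt (x y e : R) : `|x - y| < e ->
  (`|(x +i* 0)%C - (y +i* 0)%C : R[i]| < (e +i* 0)%C).
Proof.
move=> h; have -> : ((x +i* 0)%C - (y +i* 0)%C : R[i]) = ((x - y) +i* 0)%C.
  by simpc.
by rewrite normc_def /= expr0n addr0 sqrtr_sqr ltcR.
Qed.

Lemma continuous_realcplx : continuous (fun x : R => cplx x 0).
Proof.
move=> x; apply/cvgrPdist_lt => e; rewrite /= => e0.
have eE : e = cplx (complex.Re e) 0.
  by case: e e0 => a b; rewrite /cplx ltcE /= => /andP[/eqP -> _].
have e1 : 0 < complex.Re e by move: e0; rewrite eE ltcE /= => /andP[].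
near=> y; rewrite eE; apply: realcplx_dist_lt; near: y.
by have /cvgrPdist_lt := @cvg_id _ (nbhs x); exact.
Unshelve. all: by end_near. Qed.

Lemma continuous_cplx (T : topologicalType) (f g : T -> R) (x : T) :
  {for x, continuous f} -> {for x, continuous g} ->
  {for x, continuous (fun t => cplx (f t) (g t))}.
Proof.
move=> cf cg.
have E : (fun t => cplx (f t) (g t)) = (fun t => cplx (f t) 0 + cplx 0 1 * cplx (g t) 0).
  by apply/funext => t; exact: cplxE.
rewrite /prop_for /continuous_at E [cplx (f x) (g x)]cplxE.
apply: (@continuous_addrM (Cplx R) T (cplx 0 1) (fun t => cplx (f t) 0) (fun t => cplx (g t) 0)).
  by apply: (@continuous_comp _ _ _ f (fun x => cplx x 0)) => //; exact: continuous_realcplx.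
by apply: (@continuous_comp _ _ _ g (fun x => cplx x 0)) => //; exact: continuous_realcplx.
Qed.

(** This is exp(2 pi i t), normalised so that its kernel is the group of integers. *)
Definition expi (t : R) : Cplx R := cplx (cos (t * (pi *+ 2))) (sin (t * (pi *+ 2))).

Lemma continuous_expi : continuous expi.
Proof.
move=> x; apply: continuous_cplx.
  apply: continuous_comp; last exact: continuous_cos.
  by apply: cvgM; [exact: cvg_id|exact: cvg_cst].
apply: continuous_comp; last exact: continuous_sin.
by apply: cvgM; [exact: cvg_id|exact: cvg_cst].
Qed.

Lemma expiD s t : expi (s + t) = expi s * expi t.
Proof.
rewrite /expi /cplx mulrDl cosD sinD; simpc; congr (_ +i* _)%C.
by rewrite addrC; congr (_ + _); rewrite mulrC.
Qed.

Lemma expi0 : expi 0 = 1.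
Proof. by rewrite /expi mul0r cos0 sin0. Qed.

Lemma expi1 : expi 1 = 1.
Proof. by rewrite /expi mul1r cos2pi sin2pi. Qed.

Lemma expiN t : expi (- t) = Num.conj (expi t).
Proof. by rewrite /expi /cplx mulNr cosN sinN. Qed.

Lemma expi_conj t : expi t * Num.conj (expi t) = 1.
Proof. by rewrite -expiN -expiD subrr expi0. Qed.

Lemma expi_neq0 t : expi t != 0.
Proof.
apply/eqP => h; have := expi_conj t; rewrite h mul0r => /eqP.
by rewrite eq_sym oner_eq0.
Qed.

Lemma expi_nat n : expi n%:R = 1.
Proof.
by elim: n => [|n ih]; [exact: expi0|rewrite -natr1 expiD ih expi1 mul1r].
Qed.

Lemma expi_int t : t \is a Num.int -> expi t = 1.
Proof.
move=> /intrP[[] n ->]; first exact: expi_nat.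
by rewrite NegzE mulrNz expiN expi_nat rmorph1.
Qed.

Lemma expi_eq1 t : expi t = 1 <-> t \is a Num.int.
Proof.
split; last exact: expi_int.
have tE : t = (Num.floor t)%:~R + (t - (Num.floor t)%:~R) by rewrite addrC subrK.
have /andP[f0 f1] : 0 <= t - (Num.floor t)%:~R < 1.
  by rewrite subr_ge0 ge_floor ltrBlDl -[X in _ < _ + X]/(1%:~R) -intrD lt_succ_floor.
move: (t - _) tE f0 f1 => f -> f0 f1.
rewrite expiD expi_int ?mul1r ?rpred_int// => ef.
move: f0; rewrite le_eqVlt => /predU1P[<-|f0]; first by rewrite addr0 rpred_int.
have : 0 < sin (f * pi).
  by apply: sin_gt0_pi; rewrite mulr_gt0 ?pi_gt0//= gtr_pMl ?pi_gt0.
have : cos (f * (pi *+ 2)) = 1 by case: ef.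
(* Half angle: cos(2 pi f) = 1 - 2 sin^2(pi f), while sin(pi f) > 0 for 0 < f < 1. *)
rewrite mulrnAr cos_mulr2n cos2sin2 => h hs.
have : sin (f * pi) ^+ 2 = 0 by move: h; set s := (sin _ ^+ 2) => h; lra.
by move/eqP; rewrite sqrf_eq0 gt_eqF.
Qed.

Lemma expi_eq s t : expi s = expi t <-> s - t \is a Num.int.
Proof.
rewrite -expi_eq1 expiD expiN; split=> [->|h]; first exact: expi_conj.
apply: (mulIf (expi_neq0 (- t))); by rewrite expiN expi_conj.
Qed.

Lemma expi_surj (z : Cplx R) : z * Num.conj z = 1 -> exists t, z = expi t.
Proof.
case: z => x y h.
have hxy : x ^+ 2 + y ^+ 2 = 1.
  move: h; rewrite -[Num.conj _]/((x -i* y)%C); simpc => -[h _].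
  by rewrite -h !expr2.
have hx : -1 <= x <= 1.
  by apply/andP; split; nra.
have pi0 := pi_gt0 R.
have pi20 : (pi *+ 2 : R) != 0 by rewrite gt_eqF// mulrn_wgt0.
have tE (u : R) : u / (pi *+ 2) * (pi *+ 2) = u by rewrite divfK.
have sE : sin (acos x) = `|y|.
  by rewrite sin_acos// -sqrtr_sqr; congr Num.sqrt; lra.
have [y0|y0] := leP 0 y.
  exists (acos x / (pi *+ 2)); rewrite /expi tE sE acosK ?in_itv//=.
  by rewrite ger0_norm.
exists (- acos x / (pi *+ 2)); rewrite /expi tE cosN sinN sE acosK ?in_itv//=.
by rewrite ltr0_norm// opprK.
Qed.

Lemma compact_cplx_box : exists2 K : set (Cplx R), compact K & forall z : Cplx R, `|z| <= 1 -> K z.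
Proof.
exists ((fun p : R * R => cplx p.1 p.2) @` (`[-1, 1] `*` `[-1, 1])).
  apply: continuous_compact; last by apply: compact_setX; exact: segment_compact.
  apply: continuous_subspaceT => p; apply: continuous_cplx; [exact: cvg_fst|exact: cvg_snd].
case=> x y; rewrite normc_def/= lecR => h.
have h2 : x ^+ 2 + y ^+ 2 <= 1.
  rewrite -(ler_sqrt (x ^+ 2 + y ^+ 2)) ?ler01// sqrtr1//.
exists (x, y) => //; split; rewrite /= in_itv/= -ler_norml.
  by rewrite -[leRHS](sqrtr1 R) -sqrtr_sqr ler_sqrt//; nra.
by rewrite -[leRHS](sqrtr1 R) -sqrtr_sqr ler_sqrt//; nra.
Qed.

End ComplexPlane.

(** * Quotients, subspaces and products *)

Lemma eq_continuous_for (S T : topologicalType) (f g : S -> T) (x : S) :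
  f =1 g -> {for x, continuous f} -> {for x, continuous g}.
Proof. by move=> /funext ->. Qed.

Section Quotient.
Variables (T : topologicalType) (r : T -> T -> Prop).
Hypothesis rr : forall x, r x x.
Hypothesis rs : forall x y, r x y -> r y x.
Hypothesis rt : forall x y z, r x y -> r y z -> r x z.

Lemma qpi_surj (c : quot_by r) : exists x, c = qpi r x.
Proof. by case: c => A hA; have /asboolP[x xA] := hA; exists x; apply: val_inj. Qed.

Lemma qpi_eq x y : qpi r x = qpi r y <-> r x y.
Proof.
split=> [[->]|h]; first exact: rr.
apply: val_inj => /=; apply/seteqP; split=> z /= hz; last exact: rt hz.
by apply: rt hz; exact: rs.
Qed.

Lemma continuous_qpi : continuous (qpi r).
Proof. by apply/continuousP => A. Qed.

(** Classes are closed, so normality separates two of them by open sets. These are then shrunk to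
    saturated ones, namely complements of saturations of closed sets, which are open by the last
    hypothesis. *)
Lemma hausdorff_quot : hausdorff_space T -> compact [set: T] ->
  (forall C : set T, closed C -> closed [set y | exists2 x, C x & r x y]) ->
  hausdorff_space (quot_by r).
Proof.
move=> hT cT satC; rewrite open_hausdorff => a b.
have [x ->] := qpi_surj a; have [y ->] := qpi_surj b => /eqP xy.
have nxy : ~ r x y by move=> h; apply: xy; exact/qpi_eq.
have fiber z : closed [set t | r z t].
  rewrite (_ : mkset _ = [set y | exists2 x, [set z] x & r x y]).
    by apply: satC; apply: accessible_closed_set1; exact: hausdorff_accessible.
  by apply/seteqP; split=> t /=; [exists z|move=> [_ ->]].
have : set_nbhs [set t | r x t] (~` [set t | r y t]).
  apply/set_nbhsP; exists (~` [set t | r y t]); split=> //.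
    exact/closed_openC/fiber.
  by move=> t /= xt yt; apply: nxy; apply: rt xt _; exact: rs.
move=> /(compact_normal hT cT (fiber x))[V /set_nbhsP[C [oC xC CV]] clV].
pose W1 := ~` [set t | exists2 s, (~` C) s & r s t].
pose W2 := ~` [set t | exists2 s, closure V s & r s t].
have oW1 : open W1 by apply/closed_openC/satC/open_closedC.
have oW2 : open W2 by apply/closed_openC/satC/closed_closure.
have sat D : qpi r @^-1` (qpi r @` (~` [set t | exists2 s, D s & r s t])) =
   ~` [set t | exists2 s, D s & r s t].
  apply/seteqP; split=> [t [u hu /qpi_eq ut] [s Ds st]|t ht]; last by exists t.
  by apply: hu; exists s => //; apply: rt st _; exact: rs.
exists (qpi r @` W1, qpi r @` W2) => /=.
  split; rewrite inE.
    exists x => // -[s Cs sx]; apply: Cs; apply: xC; exact: rs.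
  by exists y => // -[s Vs sy]; apply: (clV _ Vs); exact: rs.
split; [by rewrite /open/= /quot_open sat|by rewrite /open/= /quot_open sat|].
apply/eqP/seteqP; split=> // c [[u W1u <-] [v W2v /qpi_eq uv]].
apply: W2v; exists u; last exact: rs.
apply: subset_closure; apply: CV; apply: contrapT => Cu; apply: W1u; by exists u.
Qed.

End Quotient.

Lemma compact_set_type (T : topologicalType) (A : set T) :
  compact A -> compact [set: set_type A].
Proof.
move=> cA F PF _.
have [|p [Ap hp]] := cA (set_val @ F) _.
  by apply: nearW => x /=; exact: set_mem (valP x).
exists (exist _ p (mem_set Ap)); split=> // B C FB.
rewrite nbhsE => -[D [[W oW <-] Wp] DC].
have FV : F (set_val @^-1` (set_val @` B)) by apply: filterS FB => z Bz; exists z.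
have [q [[z Bz zq] Wq]] := hp (set_val @` B) W FV (open_nbhs_nbhs (conj oW Wp)).
by exists z; split=> //; apply: DC; rewrite /= zq.
Qed.

Lemma hausdorff_set_type (T : topologicalType) (A : set T) :
  hausdorff_space T -> hausdorff_space (set_type A).
Proof.
move=> hT x y h; apply: val_inj; apply: hT => B C nB nC.
have cv : continuous (set_val : set_type A -> T) by exact: initial_continuous.
have [z [Bz Cz]] := h _ _ (cv x B nB) (cv y C nC).
by exists (val z).
Qed.

Lemma continuous_to_set_type (S T : topologicalType) (A : set T)
    (f : S -> set_type A) (x : S) :
  {for x, continuous (fun s => val (f s))} -> {for x, continuous f}.
Proof.
move=> h B; rewrite nbhsE => -[D [[W oW <-] Wp] DC].
have nW : nbhs x [set s | W (val (f s))] by exact: h W (open_nbhs_nbhs (conj oW Wp)).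
have sub : [set s | W (val (f s))] `<=` f @^-1` B by move=> s; exact: DC.
exact: filterS sub nW.
Qed.

Lemma continuous_to_ptws (S T : topologicalType) (I : eqType)
    (f : S -> {ptws I -> T}) (x : S) :
  (forall i, {for x, continuous (fun s => f s i)}) -> {for x, continuous f}.
Proof.
move=> h; apply/cvg_sup => i B; rewrite nbhsE => -[D [[W oW <-] Wp] DC].
have nW : nbhs x [set s | W (f s i)] by exact: h i W (open_nbhs_nbhs (conj oW Wp)).
have sub : [set s | W (f s i)] `<=` f @^-1` B by move=> s; exact: DC.
exact: filterS sub nW.
Qed.

Lemma continuous_to_mx (S T : topologicalType) m n (f : S -> 'M[T]_(m, n)) (x : S) :
  (forall i j, {for x, continuous (fun s => f s i j)}) -> {for x, continuous f}.
Proof.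
move=> h A [P hP sPA].
have : nbhs x [set s | forall ij : 'I_m * 'I_n, P ij.1 ij.2 (f s ij.1 ij.2)].
  by apply: filter_forall => -[i j]; exact: h (hP i j).
apply: filterS => s hs; apply: sPA => i j; exact: (hs (i, j)).
Qed.

Lemma compact_mx (T : topologicalType) m n (K : set T) : compact K ->
  compact [set M : 'M[T]_(m, n) | forall i j, K (M i j)].
Proof.
move=> cK.
have cP := @tychonoff _ (fun _ : 'I_m * 'I_n => T) _ (fun _ => cK).
pose F (f : {ptws ('I_m * 'I_n) -> T}) : 'M[T]_(m, n) := \matrix_(i, j) f (i, j).
rewrite (_ : mkset _ = F @` [set f : {ptws ('I_m * 'I_n) -> T} | forall i, K (f i)]).
  apply: continuous_compact; last exact: cP.
  apply: continuous_subspaceT => f; apply: continuous_to_mx => i j.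
  apply: (@eq_continuous_for {ptws ('I_m * 'I_n) -> T} T
    (fun f => f (i, j)) (fun f => F f i j) f).
    by move=> g; rewrite mxE.
  exact: (@proj_continuous _ (fun=> T) (i, j) f).
apply/seteqP; split=> [M hM|_ [f hf <-] i j]; last by rewrite mxE; exact: hf.
by exists (fun ij => M ij.1 ij.2) => //; apply/matrixP => i j; rewrite mxE.
Qed.

(** * The space of representations modulo conjugation *)

Section MatrixContinuity.
Variables (K : numClosedFieldType) (S : topologicalType).

Lemma continuous_conjC : continuous (@Num.conj K : K -> K).
Proof.
move=> x A /nbhs_ballP[e /= e0 eA]; apply/nbhs_ballP; exists e => // y.
rewrite -ball_normE /= => xy; apply: eA.
by rewrite -ball_normE /= -rmorphB norm_conjC.
Qed.

Lemma continuous_bigsum (I : Type) (r : seq I) (F : I -> S -> K) x :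
  (forall i, {for x, continuous (F i)}) ->
  {for x, continuous (fun s => \sum_(i <- r) F i s)}.
Proof.
move=> h; elim: r => [|i r ih].
  apply: (@eq_continuous_for S K (fun=> 0)); first by move=> s; rewrite big_nil.
  exact: cvg_cst.
apply: (@eq_continuous_for S K (fun s => F i s + \sum_(j <- r) F j s)).
  by move=> s; rewrite big_cons.
by apply: cvgD => //; exact: h.
Qed.

Lemma continuous_mulf (f g : S -> K) x : {for x, continuous f} ->
  {for x, continuous g} -> {for x, continuous (fun s => f s * g s)}.
Proof. exact: cvgM. Qed.

Definition mx_continuous_at m n (x : S) (f : S -> 'M[K]_(m, n)) :=
  forall i j, {for x, continuous (fun s => f s i j)}.

Lemma mx_continuous_cst m n x (M : 'M[K]_(m, n)) : mx_continuous_at x (fun=> M).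
Proof. by move=> i j; exact: cvg_cst. Qed.

Lemma mx_continuous_mul m n p x (f : S -> 'M[K]_(m, n)) (g : S -> 'M[K]_(n, p)) :
  mx_continuous_at x f -> mx_continuous_at x g ->
  mx_continuous_at x (fun s => f s *m g s).
Proof.
move=> cf cg i j.
apply: (@eq_continuous_for S K (fun s => \sum_k f s i k * g s k j)).
  by move=> s; rewrite mxE.
by apply: continuous_bigsum => k; apply: cvgM; [exact: cf|exact: cg].
Qed.

Lemma closed_eq_fun (f g : S -> K) : continuous f -> continuous g ->
  closed [set x | f x = g x].
Proof.
move=> cf cg; rewrite (_ : mkset _ = (fun x => f x - g x) @^-1` [set 0]).
  apply: closed_comp.
    by move=> x _; apply: cvgB; [exact: cf|exact: cg].
  apply: accessible_closed_set1; apply: hausdorff_accessible; exact: norm_hausdorff.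
apply/seteqP; split=> x /=; first by move=> ->; rewrite subrr.
by move/eqP; rewrite subr_eq0 => /eqP.
Qed.

Lemma closed_eq_mx m n (f g : S -> 'M[K]_(m, n)) :
  (forall x, mx_continuous_at x f) -> (forall x, mx_continuous_at x g) ->
  closed [set x | f x = g x].
Proof.
move=> cf cg.
rewrite (_ : mkset _ = \bigcap_(ij in [set: 'I_m * 'I_n]) [set x | f x ij.1 ij.2 = g x ij.1 ij.2]).
  apply: closed_bigI => -[i j] _; apply: closed_eq_fun => x; [exact: cf|exact: cg].
apply/seteqP; split=> x /=; first by move=> fg [i j] _ /=; rewrite fg.
by move=> h; apply/matrixP => i j; exact: (h (i, j)).
Qed.

End MatrixContinuity.

Section Hom.
Variables (R : realType) (G : groupType) (n : nat).
Local Notation C := (Cplx R).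
Local Notation M := ('M[C]_n).

Lemma mx_continuous_ctr (S : topologicalType) x (f : S -> M) :
  mx_continuous_at x f -> mx_continuous_at x (fun s => ctrmx (f s)).
Proof.
move=> cf i j; apply: (@eq_continuous_for S C (fun s => Num.conj (f s j i))).
  by move=> s; rewrite !mxE.
by apply: continuous_comp; [exact: cf|exact: continuous_conjC].
Qed.

Lemma mx_continuous_comp (S : topologicalType) x (f : S -> M) :
  {for x, continuous f} -> mx_continuous_at x f.
Proof.
move=> cf i j.
by apply: (@continuous_comp _ _ _ f (fun A : M => A i j)) => //; exact: coord_continuous.
Qed.

Lemma compact_bounded_mx (A : set M) : closed A ->
  (forall U i j, A U -> `|U i j| <= 1) -> compact A.
Proof.
move=> clA hA; have [K cK hK] := compact_cplx_box R.
apply: (subclosed_compact clA (@compact_mx C n n K cK)).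
by move=> U AU i j; apply: hK; exact: hA.
Qed.

Lemma compact_unitary : compact [set U : M | unitary U].
Proof.
apply: compact_bounded_mx; last by move=> U i j; exact: unitary_norm_le1.
apply: closed_eq_mx => U; last exact: mx_continuous_cst.
apply: mx_continuous_mul; first by apply: mx_continuous_comp; exact: cvg_id.
by apply: mx_continuous_ctr; apply: mx_continuous_comp; exact: cvg_id.
Qed.

Lemma ptws_proj_continuous (g : G) (rho : {ptws G -> M}) :
  {for rho, continuous (fun f : {ptws G -> M} => f g)}.
Proof. exact: (@proj_continuous G (fun=> M) g rho). Qed.

Lemma hom_set_closed : closed (@hom_set R G n).
Proof.
rewrite (_ : @hom_set R G n =
  (\bigcap_(g in [set: G]) [set f : {ptws G -> M} | f g *m ctrmx (f g) = 1%:M])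
  `&` (\bigcap_(gh in [set: G * G])
    [set f : {ptws G -> M} | f (gh.1 * gh.2)%g = f gh.1 *m f gh.2])).
  have cp g (f : {ptws G -> M}) : mx_continuous_at f (fun f : {ptws G -> M} => f g).
    by apply: mx_continuous_comp; exact: ptws_proj_continuous.
  apply: closedI; apply: closed_bigI => g _; apply: closed_eq_mx => f.
  - by apply: mx_continuous_mul; [exact: cp|apply: mx_continuous_ctr; exact: cp].
  - exact: mx_continuous_cst.
  - exact: cp.
  - by apply: mx_continuous_mul; exact: cp.
apply/seteqP; split=> f /=.
  by move=> [uf mf]; split=> [g _|[g h] _] /=; [exact: uf|exact: mf].
by move=> [uf mf]; split=> [g|g h]; [exact: uf|exact: (mf (g, h))].
Qed.

Lemma hom_set_compact : compact (@hom_set R G n).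
Proof.
apply: (subclosed_compact hom_set_closed (@tychonoff G (fun=> M) _ (fun=> compact_unitary))).
by move=> f [uf _] g; exact: uf.
Qed.

Lemma hausdorff_ptws : hausdorff_space {ptws G -> M}.
Proof.
apply: (@hausdorff_product G (fun=> M)) => _ A B h; apply/matrixP => i j.
apply: (@norm_hausdorff C C) => P Q nP nQ.
have [Z [PZ QZ]] := h _ _ (@coord_continuous C n n i j A P nP) (@coord_continuous C n n i j B Q nQ).
by exists (Z i j).
Qed.

(** The saturation comes from the image of the compact set U(n) x [D] under the conjugation map, and
    a compact subset of a Hausdorff space is closed. *)
Lemma closed_conj_saturation (D : set (HomSp R G n)) : closed D ->
  closed [set rho : HomSp R G n | exists2 sigma : HomSp R G n, D sigma &
    conj_equiv (val sigma : G -> M) (val rho)].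
Proof.
move=> cD.
pose E : set {ptws G -> M} := val @` D.
have cE : compact E.
  apply: continuous_compact.
    apply: continuous_subspaceT; exact: initial_continuous.
  apply: (subclosed_compact cD (compact_set_type hom_set_compact)) => //.
pose F (p : M * {ptws G -> M}) : {ptws G -> M} := fun g => p.1 *m p.2 g *m ctrmx p.1.
have cF : compact (F @` ([set U : M | unitary U] `*` E)).
  apply: continuous_compact; last exact: compact_setX compact_unitary cE.
  apply: continuous_subspaceT => p; apply: continuous_to_ptws => g.
  apply: continuous_to_mx.
  have c1 : mx_continuous_at p (fun p : M * {ptws G -> M} => p.1).
    by apply: mx_continuous_comp; exact: cvg_fst.
  apply: mx_continuous_mul; last by apply: mx_continuous_ctr; exact: c1.
  apply: mx_continuous_mul; first exact: c1.
  apply: mx_continuous_comp.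
  apply: (@continuous_comp _ _ _ snd (fun f : {ptws G -> M} => f g)); first exact: cvg_snd.
  exact: ptws_proj_continuous.
have clF := compact_closed hausdorff_ptws cF.
have : closed ((val : HomSp R G n -> {ptws G -> M}) @^-1` (F @` ([set U : M | unitary U] `*` E))).
  by apply: closed_comp clF => x _; exact: initial_continuous.
congr closed; apply/seteqP; split=> rho /=.
  move=> [[U _] [/= uU [sigma Ds <-]] h]; exists sigma => //.
  by exists U; split=> // g; rewrite -h.
move=> [sigma Ds [U [uU h]]]; exists (U, val sigma); first by split=> //; exists sigma.
by apply/funext => g; rewrite h.
Qed.

(** Being non-scalar is an open condition on [T]. Removing the trace part and normalising the
    Hilbert-Schmidt norm replaces it by a compact one without changing what [T] commutes with. *)
Lemma traceless_norm1_exists (T : M) : ~~ is_scalar_mx T -> exists a b : C,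
  let T' := a *: (T - b%:M) in \tr T' = 0 /\ \sum_i \sum_j T' i j * Num.conj (T' i j) = 1.
Proof.
move=> nT.
have n0 : (0 < n)%N.
  by case: n T nT => // T /negP[]; apply/is_scalar_mxP; exists 0; apply/matrixP => -[].
pose b := (\tr T) / n%:R.
pose T1 := T - b%:M.
have tr1 : \tr T1 = 0.
  rewrite /T1 mxtraceD raddfN /= mxtrace_scalar -[b *+ n]mulr_natr /b.
  by rewrite divfK ?subrr// pnatr_eq0 -lt0n.
pose N := \sum_i \sum_j T1 i j * Num.conj (T1 i j).
have N0 : 0 <= N by apply: sumr_ge0 => i _; apply: sumr_ge0 => j _; rewrite mul_conjC_ge0.
have NN : N != 0.
  apply/eqP => h; case/negP: nT; apply/is_scalar_mxP; exists b; apply/eqP.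
  rewrite -subr_eq0; apply/eqP/matrixP => i j; rewrite [RHS]mxE.
  have : T1 i j * Num.conj (T1 i j) <= N.
    rewrite /N (bigD1 i)//= (bigD1 j)//= -addrA lerDl addr_ge0// sumr_ge0// => l _.
      by rewrite mul_conjC_ge0.
    by apply: sumr_ge0 => ? _; rewrite mul_conjC_ge0.
  rewrite h => hle; apply/eqP; rewrite -mul_conjC_eq0.
  by apply/eqP/le_anti; rewrite hle mul_conjC_ge0.
exists (sqrtC N)^-1, b => /=; rewrite -/T1; split; first by rewrite mxtraceZ tr1 mulr0.
have sar : Num.conj (sqrtC N)^-1 = (sqrtC N)^-1.
  by apply: CrealP; rewrite realE invr_ge0 sqrtC_ge0 N0.
transitivity ((sqrtC N)^-1 ^+ 2 * N).
  rewrite /N mulr_sumr; apply: eq_bigr => i _; rewrite mulr_sumr; apply: eq_bigr => j _.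
  by rewrite !mxE rmorphM/= sar mulrACA -expr2.
by rewrite exprVn sqrtCK mulVf.
Qed.

(** The locus is the projection of the compact set of pairs of a normalised non-scalar [T] and a
    representation commuting with it. *)
Lemma closed_reducible :
  closed [set rho : HomSp R G n | reducible (val rho : G -> M)].
Proof.
pose K := [set T : M | \tr T = 0] `&` [set T : M | \sum_i \sum_j T i j * Num.conj (T i j) = 1].
have cid (T : M) : mx_continuous_at T (fun T : M => T).
  by apply: mx_continuous_comp; exact: cvg_id.
have cK : compact K.
  apply: compact_bounded_mx.
    apply: closedI; apply: closed_eq_fun => T.
    - by apply: continuous_bigsum => i; exact: cid.
    - exact: cst_continuous.
    - apply: continuous_bigsum => i; apply: continuous_bigsum => j.
      apply: continuous_mulf; first exact: cid.
      by apply: (@continuous_comp _ _ _ (fun T : M => T i j) (@Num.conj C));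
        [exact: cid|exact: continuous_conjC].
    - exact: cst_continuous.
  move=> T i j [_ /= h].
  rewrite -(@ler_sqr _ `|T i j|) ?nnegrE// expr1n -h (bigD1 i)//= (bigD1 j)//= -normCK -addrA lerDl.
  rewrite addr_ge0// ?sumr_ge0// => l _; rewrite ?mul_conjC_ge0//.
  by apply: sumr_ge0 => ? _; rewrite mul_conjC_ge0.
pose E := (K `*` @hom_set R G n) `&`
  \bigcap_(g in [set: G]) [set p : M * {ptws G -> M} | p.1 *m p.2 g = p.2 g *m p.1].
have cE : compact E.
  apply: compact_closedI; first exact: compact_setX cK hom_set_compact.
  have c1 (p : M * {ptws G -> M}) : mx_continuous_at p (fun p : M * {ptws G -> M} => p.1).
    by apply: mx_continuous_comp; exact: cvg_fst.
  have c2 g (p : M * {ptws G -> M}) : mx_continuous_at p (fun p : M * {ptws G -> M} => p.2 g).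
    apply: mx_continuous_comp.
    apply: (@continuous_comp _ _ _ snd (fun f : {ptws G -> M} => f g)); first exact: cvg_snd.
    exact: ptws_proj_continuous.
  apply: closed_bigI => g _; apply: closed_eq_mx => p.
    by apply: mx_continuous_mul; [exact: c1|exact: c2].
  by apply: mx_continuous_mul; [exact: c2|exact: c1].
have cF : compact (snd @` E).
  by apply: continuous_compact cE; apply: continuous_subspaceT => p; exact: cvg_snd.
have clF := compact_closed hausdorff_ptws cF.
have : closed ((val : HomSp R G n -> {ptws G -> M}) @^-1` (snd @` E)).
  by apply: closed_comp clF => x _; exact: initial_continuous.
congr closed; apply/seteqP; split=> rho /=.
  move=> [[T f] [[/= [trT nT] rf] hT] /= fE].
  apply/reducibleP; first exact: set_mem (valP rho).
  exists T; first by move=> g; rewrite -fE; exact: hT.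
  apply/negP => /is_scalar_mxP[a aE]; move: trT nT; rewrite aE /= mxtrace_scalar => h s1.
  have n0 : (0 < n)%N.
    case: (posnP n) => // n0.
    move: s1; rewrite big1 => [/eqP|i _]; first by rewrite eq_sym oner_eq0.
    by exfalso; have := ltn_ord i; rewrite {2}n0.
  move: s1; have -> : a = 0.
    move/eqP: h; rewrite -mulr_natr mulf_eq0 pnatr_eq0 => /orP[/eqP//|/eqP h].
    by rewrite h in n0.
  rewrite big1 => [/eqP|i _]; first by rewrite eq_sym oner_eq0.
  by rewrite big1// => j _; rewrite !mxE mul0rn mul0r.
have rr : is_rep (val rho : G -> M) by exact: set_mem (valP rho).
move/(reducibleP rr) => [T hT /traceless_norm1_exists[a [b [h1 h2]]]].
exists (a *: (T - b%:M), val rho) => //; split; first by split=> //=.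
move=> g _ /=; rewrite -scalemxAl -scalemxAr mulmxBl mulmxBr hT.
by rewrite scalar_mxC.
Qed.

Lemma irr_rel_refl (x : plus_pt (HomSp R G n)) : irr_rel x x.
Proof.
case: x => -[] x; last by left.
by right; exists x, x; split=> //; exact: conj_equiv_refl.
Qed.

Lemma irr_rel_sym (x y : plus_pt (HomSp R G n)) : irr_rel x y -> irr_rel y x.
Proof.
case=> [[hx hy]|[a [b [xa yb ab]]]]; first by left.
by right; exists b, a; split=> //; exact: conj_equiv_sym.
Qed.

Lemma irr_rel_collapsed (x y : plus_pt (HomSp R G n)) :
  irr_rel x y -> collapsed x -> collapsed y.
Proof.
case=> [[]//|[a [b [xa yb ab]]]]; rewrite /collapsed xa yb.
exact: reducible_conj.
Qed.

Lemma irr_rel_trans (x y z : plus_pt (HomSp R G n)) :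
  irr_rel x y -> irr_rel y z -> irr_rel x z.
Proof.
move=> xy; case=> [[hy hz]|[b [c [yb zc bc]]]].
  by left; split=> //; apply: irr_rel_collapsed hy; exact: irr_rel_sym.
case: xy => [[hx hy]|[a [b' [xa yb' ab]]]].
  left; split=> //; apply: irr_rel_collapsed hy; right; by exists b, c.
move: yb'; rewrite yb => -[bE]; rewrite -{b'}bE in ab.
by right; exists a, c; split=> //; apply: conj_equiv_trans ab bc.
Qed.

Lemma hausdorff_IrrPlus : hausdorff_space (IrrPlus R G n).
Proof.
have hH : hausdorff_space (HomSp R G n) by apply: hausdorff_set_type; exact: hausdorff_ptws.
have cH : compact [set: HomSp R G n] by apply: compact_set_type; exact: hom_set_compact.
apply: hausdorff_quot.
- exact: irr_rel_refl.
- exact: irr_rel_sym.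
- exact: irr_rel_trans.
- by apply: sigT_hausdorff => -[] //; exact: discrete_hausdorff.
- apply: sigT_compact; first exact: finite_finset.
  case => //; apply: finite_compact; exact: finite_finset.
- move=> D cD; rewrite -openC; apply/sigT_openP => -[]; last exact: discrete_open.
  rewrite -preimage_setC openC.
  pose D' := existT (plus_pt_fam (HomSp R G n)) true @^-1` D.
  have cD' : closed D' by apply: closed_comp cD => x _; exact: existT_continuous.
  have cS := closed_conj_saturation cD'.
  (* If [D] meets the collapsed points, its saturation also contains all reducible representations;
     otherwise it is the conjugation saturation alone. *)
  have [[d Dd cd]|nd] := pselect (exists2 d, D d & collapsed d).
    have := closedU cS closed_reducible; congr closed; apply/seteqP; split=> rho /=.
      case=> [[sigma Ds sr]|rr]; last by exists d => //; left.
      by exists (existT _ true sigma) => //; right; exists sigma, rho.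
    move=> [x Dx [[cx crho]|[a [b [xa [<-] ab]]]]]; first by right.
    by left; exists a => //; case: x xa Dx => -[]//= v [<-].
  move: cS; congr closed; apply/seteqP; split=> rho /=.
    case=> [sigma Ds sr].
    by exists (existT _ true sigma) => //; right; exists sigma, rho.
  move=> [x Dx [[cx crho]|[a [b [xa [<-] ab]]]]]; first by case: nd; exists x.
  by exists a => //; case: x xa Dx => -[]//= v [<-].
Qed.

End Hom.

(** * Finite CW structures and polytopes *)

Section Disk.
Variable R : realType.

Lemma continuous_Rsum (S : topologicalType) (I : Type) (r : seq I) (F : I -> S -> R) x :
  (forall i, {for x, continuous (F i)}) ->
  {for x, continuous (fun s => \sum_(i <- r) F i s)}.
Proof.
move=> h; elim: r => [|i r ih].
  apply: (@eq_continuous_for S R (fun=> 0)); first by move=> s; rewrite big_nil.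
  exact: cvg_cst.
apply: (@eq_continuous_for S R (fun s => F i s + \sum_(j <- r) F j s)).
  by move=> s; rewrite big_cons.
by apply: cvgD => //; exact: h.
Qed.

Lemma continuous_Rmax (S : topologicalType) (I : Type) (r : seq I) (F : I -> S -> R) x :
  (forall i, {for x, continuous (F i)}) ->
  {for x, continuous (fun s => \big[Num.max/0]_(i <- r) F i s)}.
Proof.
move=> h; elim: r => [|i r ih].
  apply: (@eq_continuous_for S R (fun=> 0)); first by move=> s; rewrite big_nil.
  exact: cvg_cst.
apply: (@eq_continuous_for S R (fun s => Num.max (F i s) (\big[Num.max/0]_(j <- r) F j s))).
  by move=> s; rewrite big_cons.
by apply: continuous_max => //; exact: h.
Qed.

Lemma continuous_mulR (S : topologicalType) (f g : S -> R) x :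
  {for x, continuous f} -> {for x, continuous g} ->
  {for x, continuous (fun s => f s * g s)}.
Proof. exact: cvgM. Qed.

Lemma continuous_addR (S : topologicalType) (f g : S -> R) x :
  {for x, continuous f} -> {for x, continuous g} ->
  {for x, continuous (fun s => f s + g s)}.
Proof. exact: cvgD. Qed.

Lemma continuous_subR (S : topologicalType) (f g : S -> R) x :
  {for x, continuous f} -> {for x, continuous g} ->
  {for x, continuous (fun s => f s - g s)}.
Proof. exact: cvgB. Qed.

Lemma continuous_invR (S : topologicalType) (f : S -> R) x :
  f x != 0 -> {for x, continuous f} -> {for x, continuous (fun s => (f s)^-1)}.
Proof. exact: cvgV. Qed.

Lemma continuous_sqnorm m : continuous (@sqnorm R m).
Proof.
move=> v; apply: continuous_Rsum => i.
apply: (@eq_continuous_for _ R (fun v : 'rV[R]_m => v ord0 i * v ord0 i)).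
  by move=> w; rewrite expr2.
by apply: continuous_mulR; exact: coord_continuous.
Qed.

Lemma sqnorm_ge0 m (v : 'rV[R]_m) : 0 <= sqnorm v.
Proof. by apply: sumr_ge0 => i _; rewrite sqr_ge0. Qed.

Lemma sqnormZ m a (v : 'rV[R]_m) : sqnorm (a *: v) = a ^+ 2 * sqnorm v.
Proof. by rewrite /sqnorm mulr_sumr; apply: eq_bigr => i _; rewrite mxE exprMn. Qed.

Lemma cdisk_compact m : compact (@cdisk R m).
Proof.
have cK := @rV_compact R m (fun=> `[-1, 1]%classic) (fun=> @segment_compact R (-1) 1).
apply: (subclosed_compact _ cK).
  rewrite (_ : @cdisk R m = @sqnorm R m @^-1` [set x | x <= 1])//.
  by apply: closed_comp (@closed_le R 1) => v _; exact: continuous_sqnorm.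
move=> v hv i; rewrite /= in_itv/= -ler_norml -(@ler_sqr R) ?nnegrE// expr1n real_normK ?num_real//.
apply: le_trans hv; rewrite /sqnorm (bigD1 i)//= lerDl.
by apply: sumr_ge0 => j _; rewrite sqr_ge0.
Qed.

Lemma odisk_open m : open (@odisk R m).
Proof.
rewrite (_ : @odisk R m = @sqnorm R m @^-1` [set x | x < 1])//.
by apply: open_comp (@open_lt R 1) => v _; exact: continuous_sqnorm.
Qed.

(** Closed subsets of a disk have compact, hence closed, images in the Hausdorff space [X]. With
    finitely many cells this settles the weak topology, and it also makes each [Phi i] open onto its
    open cell. *)
Lemma finite_CW (X : topologicalType) (d : nat) (I : finType) (dim : I -> nat)
    (Phi : forall i, 'rV[R]_(dim i) -> X) :
  hausdorff_space X -> (forall i, (dim i <= d)%N) ->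
  (forall i v, @cdisk R (dim i) v -> {for v, continuous (Phi i)}) ->
  (forall x, exists i v, @odisk R (dim i) v /\ Phi i v = x) ->
  (forall i j v w, @odisk R (dim i) v -> @odisk R (dim j) w ->
    Phi i v = Phi j w -> i = j) ->
  (forall i v w, @odisk R (dim i) v -> @odisk R (dim i) w ->
    Phi i v = Phi i w -> v = w) ->
  (forall i v, @bsphere R (dim i) v ->
     exists j w, [/\ (dim j < dim i)%N, @odisk R (dim j) w & Phi j w = Phi i v]) ->
  CW_dim_le R X d.
Proof.
move=> hX hdim cPhi cov disj inj bd; exists I, dim, Phi => /=.
have cPhiw i : {within @cdisk R (dim i), continuous (Phi i)}.
  by apply: continuous_in_subspaceT => v /set_mem hv; exact: cPhi.
have cim i (B : set 'rV[R]_(dim i)) : closed B -> B `<=` @cdisk R (dim i) -> closed (Phi i @` B).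
  move=> clB sB; apply: compact_closed => //; apply: continuous_compact.
    exact: continuous_subspaceW sB (cPhiw i).
  exact: (subclosed_compact clB (@cdisk_compact _) sB).
have bsE m (v : 'rV[R]_m) : cdisk v -> ~ odisk v -> bsphere v.
  by move=> h1 h2; apply/eqP; rewrite eq_le h1/= leNgt; apply/negP.
repeat split=> //.
- by move=> x; have [i [v [ov <-]]] := cov x; exists i, v.
- move=> i j x [v ov <-] [w ow e]; exact: (disj i j v w).
- by move=> i v w /set_mem ov /set_mem ow; exact: inj.
- move=> i V oV.
  (* The open set required is the complement of the image of [B]. No point of [B] hits the image of
     [V] in the open cell: interior points by injectivity, boundary points because they land in
     cells of smaller dimension. *)
  pose B := @cdisk R (dim i) `&` ~` (V `&` @odisk R (dim i)).
  have clB : closed B.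
    apply: closedI; first exact: compact_closed (@norm_hausdorff _ _) (@cdisk_compact _).
    by apply: open_closedC; apply: openI => //; exact: odisk_open.
  exists (~` (Phi i @` B)); split.
    by apply: closed_openC; apply: cim => // v [].
  apply/seteqP; split=> [_ [v [Vv ov] <-]|x [nB [v ov xv]]]; last first.
    rewrite -xv in nB *.
    exists v => //; split=> //; apply: contrapT => nV; apply: nB; exists v => //.
    by split; [exact: ltW|case].
  split; last by exists v.
  move=> [b [cb nb] e]; have [ob|nob] := pselect (odisk b).
    by apply: nb; split=> //; rewrite (inj _ _ _ ob ov e).
  have [j [w [lt ow ew]]] := bd _ _ (bsE _ _ cb nob).
  have ij : i = j by apply: (disj _ _ _ _ ov ow); rewrite ew.
  by move: lt; rewrite ij ltnn.
- move=> i v hv; have [j [w [lt ow ew]]] := bd i v hv; exists j; split=> //.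
  by exists w.
- move=> A hA.
  rewrite (_ : A = \bigcup_(i in [set: I]) (Phi i @` (@cdisk R (dim i) `&` Phi i @^-1` A))).
    apply: closed_bigcup; first exact: finite_finset.
    by move=> i _; apply: cim => // v [].
  apply/seteqP; split=> [x Ax|_ [i _ [v [_ Av] <-]]//].
  have [i [v [ov e]]] := cov x; exists i => //; exists v => //.
  by split; [exact: ltW|rewrite /= e].
Qed.

Lemma disk_onto_polytope m (J : finType) (c : J -> 'cV[R]_m) :
  (forall u : 'rV[R]_m, u != 0 -> exists j, 0 < (u *m c j) 0 0) ->
  exists h : 'rV[R]_m -> 'rV[R]_m,
  [/\ forall u, cdisk u -> {for u, continuous h},
      forall u, odisk u -> forall j, (h u *m c j) 0 0 < 1,
      forall w : 'rV[R]_m, (forall j, (w *m c j) 0 0 < 1) -> exists2 u, odisk u & h u = w,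
      forall u v, odisk u -> odisk v -> h u = h v -> u = v &
      forall u, bsphere u -> (forall j, (h u *m c j) 0 0 <= 1) /\
                          exists j, (h u *m c j) 0 0 = 1].
Proof.
(* With [p] the gauge of the polytope, [u |-> u / (p u + 1 - |u|)] is radial and
   maps the unit sphere to [p = 1]; unlike [|u| u / p u] it needs no special
   treatment at the origin. *)
move=> hc.
pose p (u : 'rV[R]_m) := \big[Num.max/0]_j (u *m c j) 0 0.
pose nm (u : 'rV[R]_m) := Num.sqrt (sqnorm u).
have fZ a (u : 'rV[R]_m) j : (a *: u *m c j) 0 0 = a * (u *m c j) 0 0.
  by rewrite -scalemxAl mxE.
have pZ a (u : 'rV[R]_m) : 0 <= a -> p (a *: u) = a * p u.
  move=> a0; rewrite /p; elim: (index_enum J) => [|j r ih]; first by rewrite !big_nil mulr0.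
  by rewrite !big_cons fZ ih maxr_pMr.
have p0 (u : 'rV[R]_m) : 0 <= p u.
  rewrite /p; elim: (index_enum J) => [|j r ih]; first by rewrite big_nil.
  by rewrite big_cons le_max ih orbT.
have pge (u : 'rV[R]_m) j : (u *m c j) 0 0 <= p u by exact: (le_bigmax _ (fun j => (u *m c j) 0 0)).
have plt (u : 'rV[R]_m) : p u < 1 <-> forall j, (u *m c j) 0 0 < 1.
  split=> [h j|h]; first exact: le_lt_trans (pge u j) h.
  by apply/bigmax_ltP; split.
have pgt (u : 'rV[R]_m) : u != 0 -> 0 < p u.
  by move=> /hc[j hj]; exact: lt_le_trans hj (pge u j).
have nZ a (u : 'rV[R]_m) : 0 <= a -> nm (a *: u) = a * nm u.
  by move=> a0; rewrite /nm sqnormZ sqrtrM ?sqr_ge0// sqrtr_sqr ger0_norm.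
have n0 (u : 'rV[R]_m) : 0 <= nm u by exact: sqrtr_ge0.
have nlt (u : 'rV[R]_m) : odisk u <-> nm u < 1.
  by rewrite /nm -(sqrtr1 R) ltr_sqrt.
have nle (u : 'rV[R]_m) : cdisk u <-> nm u <= 1.
  by rewrite /nm -(sqrtr1 R) ler_sqrt.
have ne (u : 'rV[R]_m) : bsphere u <-> nm u = 1.
  split=> [h|h]; first by rewrite /nm h sqrtr1.
  by rewrite /bsphere/= -(sqr_sqrtr (sqnorm_ge0 u)) -/(nm u) h expr1n.
pose den (u : 'rV[R]_m) : R := p u + 1 - nm u.
have den_gt0 (u : 'rV[R]_m) : cdisk u -> 0 < den u.
  move=> /nle; rewrite le_eqVlt => /predU1P[e|lt]; last by have := p0 u; rewrite /den; lra.
  have u0 : u != 0.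
    apply/eqP => u0; move: e; rewrite u0 -(scale0r 0) nZ// mul0r => /eqP.
    by rewrite eq_sym oner_eq0.
  by have := pgt u u0; rewrite /den; lra.
pose h (u : 'rV[R]_m) : 'rV[R]_m := (den u)^-1 *: u.
have ph (u : 'rV[R]_m) : cdisk u -> p (h u) = p u / den u.
  by move=> cu; rewrite /h pZ ?invr_ge0 ?ltW ?den_gt0// mulrC.
have oc (u : 'rV[R]_m) : odisk u -> cdisk u by exact: ltW.
(* Both [p] and [nm] are divided by [den u] under [h], so [1 - p (h u) + nm (h u)] equals
   [(den u)^-1]: the scaling factor is recovered from the image. *)
have hinj (u : 'rV[R]_m) : cdisk u -> p (h u) < 1 -> u = (1 - p (h u) + nm (h u))^-1 *: h u.
  move=> cu; have d0 := den_gt0 _ cu; rewrite ph// => lt.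
  rewrite /h nZ ?invr_ge0 ?ltW// scalerA -[LHS]scale1r; congr (_ *: _).
  have -> : 1 - p u / den u + (den u)^-1 * nm u = (den u)^-1.
    have E : nm u = p u + 1 - den u by rewrite /den; ring.
    by rewrite E; field; rewrite lt0r_neq0.
  by rewrite invrK divff// lt0r_neq0.
have php (u : 'rV[R]_m) : odisk u -> p (h u) < 1.
  move=> ou; have d0 := den_gt0 _ (oc _ ou); rewrite (ph _ (oc _ ou)) ltr_pdivrMr// mul1r.
  by have /nlt := ou; rewrite /den; lra.
exists h; split.
- move=> u cu; have d0 := den_gt0 _ cu; apply: continuous_to_mx => a b.
  apply: (@eq_continuous_for _ R (fun s : 'rV[R]_m => (den s)^-1 * s a b)).
    by move=> s; rewrite mxE.
  apply: continuous_mulR; last exact: coord_continuous.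
  apply: continuous_invR; first by rewrite lt0r_neq0.
  apply: continuous_subR.
    apply: continuous_addR; last exact: cst_continuous.
    apply: continuous_Rmax => j.
    apply: (@eq_continuous_for _ _ (fun s : 'rV[R]_m => \sum_k s 0 k * c j k 0)).
      by move=> s; rewrite mxE.
    by apply: continuous_Rsum => k; apply: continuous_mulR;
      [exact: coord_continuous|exact: cst_continuous].
  apply: (@continuous_comp _ _ _ (@sqnorm R m) (@Num.sqrt R)); first exact: continuous_sqnorm.
  exact: sqrt_continuous.
- by move=> u ou; apply/plt; exact: php.
- move=> w /plt pw.
  have d0 : 0 < 1 - p w + nm w by have := n0 w; lra.
  exists ((1 - p w + nm w)^-1 *: w).
    by apply/nlt; rewrite nZ ?invr_ge0 ?ltW// mulrC ltr_pdivrMr// mul1r; lra.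
  rewrite /h /den pZ ?nZ ?invr_ge0 ?ltW// scalerA -[RHS]scale1r; congr (_ *: _).
  have -> : (1 - p w + nm w)^-1 * p w + 1 - (1 - p w + nm w)^-1 * nm w = (1 - p w + nm w)^-1.
    by field; rewrite lt0r_neq0.
  by rewrite invrK divff// lt0r_neq0.
- move=> u v ou ov e.
  have hu := hinj u (oc _ ou) (php _ ou); rewrite e in hu.
  by rewrite hu; exact/esym/(hinj v (oc _ ov) (php _ ov)).
- move=> u bu; have cu : cdisk u by rewrite /cdisk/= bu.
  have d0 := den_gt0 _ cu.
  have pu : p (h u) = 1.
    rewrite ph//; move: d0; rewrite /den; have /ne -> := bu; rewrite addrK => d0.
    by rewrite divff// lt0r_neq0.
  split=> [j|]; first by rewrite -pu.
  apply: contrapT => nj; have : p (h u) < 1.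
    apply/plt => j; rewrite lt_neqAle -{2}pu pge andbT; apply/eqP => ej.
    by apply: nj; exists j.
  by rewrite pu ltxx.
Qed.

End Disk.

(** * Cells in the space of characters *)

(** The bound [N] provides a family of pairwise unrelated elements of maximal size; an element
    unrelated to all its members could be appended. *)
Lemma finite_transversal (T : Type) (E : T -> T -> Prop) (N : nat) :
  (forall x, E x x) -> (forall x y, E x y -> E y x) ->
  (forall m (f : 'I_m -> T), (forall i j, E (f i) (f j) -> i = j) -> (m <= N)%N) ->
  exists m (f : 'I_m -> T),
    (forall i j, E (f i) (f j) -> i = j) /\ forall x, exists i, E (f i) x.
Proof.
move=> Er Es Eb.
pose P m := `[< exists f : 'I_m -> T, forall i j, E (f i) (f j) -> i = j >].
have exP : exists m, P m.
  have f0 : 'I_0 -> T by case.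
  by exists 0%N; apply/asboolP; exists f0 => -[].
have bP m : P m -> (m <= N)%N by move=> /asboolP[f]; exact: Eb.
case: (ex_maxnP exP bP) => m /asboolP[f hf] maxm; exists m, f; split=> // x.
apply: contrapT => nx.
suff /maxm : P m.+1 by rewrite ltnn.
apply/asboolP; exists (fun i => if unlift ord_max i is Some j then f j else x) => i j.
case: unliftP => [i'|] ->; case: unliftP => [j'|] -> //.
- by move=> /hf ->.
- by move=> h; case: nx; exists i'.
- by move=> h; case: nx; exists j'; exact: Es.
Qed.

Section FloorLemmas.
Variable R : realType.
Implicit Types u v : R.

Lemma same_floor_ltl u v (N : int) : Num.floor u = Num.floor v ->
  u < N%:~R -> v < N%:~R.
Proof. by move=> e; rewrite -!floor_lt_int e. Qed.

Lemma same_floor_ltr u v (N : int) : Num.floor u = Num.floor v ->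
  (u \is a Num.int) = (v \is a Num.int) -> N%:~R < u -> N%:~R < v.
Proof.
move=> e ei h; rewrite lt_neqAle -floor_ge_int -e floor_ge_int ltW// andbT.
apply/eqP => Nv; have uN : Num.floor u = N by rewrite e -Nv intrKfloor.
have : u \is a Num.int by rewrite ei -Nv.
by rewrite intrEfloor uN lt_eqF.
Qed.

Lemma same_floor_int u v : Num.floor u = Num.floor v ->
  u \is a Num.int -> v \is a Num.int -> u = v.
Proof. by move=> e; rewrite !intrEfloor e => /eqP <- /eqP. Qed.

End FloorLemmas.

(* [cA] is the normal abelian subgroup and [cw a] the linear form on characters
   [x : 'rV_k] given by [a], so that [x] is the character [a |-> expi (x *m cw a)];
   [cB g] is the action of [g] on characters, [crep] and [ccos] are
   representatives of the cosets of [cA], and [cS] is a finite conjugation-stable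
   subset of [cA] separating the points of ['rV_k]. *)
Record crystal (R : realType) (G : groupType) (k : nat) := Crystal {
  cA : G -> Prop;
  cw : G -> 'cV[R]_k;
  cB : G -> 'M[R]_k;
  cm : nat;
  crep : 'I_cm -> G;
  ccos : G -> 'I_cm;
  cS : seq G;
  cA1 : cA 1%g;
  cAM : forall a b, cA a -> cA b -> cA (a * b)%g;
  cAV : forall a, cA a -> cA a^-1%g;
  cAJ : forall a g, cA a -> cA (a ^ g)%g;
  cAC : forall a b, cA a -> cA b -> (a * b = b * a)%g;
  cwM : forall a b, cA a -> cA b -> cw (a * b)%g = cw a + cw b;
  cBw : forall a g, cA a -> cB g *m cw a = cw (a ^ g)%g;
  crepK : forall i, ccos (crep i) = i;
  crepP : forall g, cA ((crep (ccos g))^-1 * g)%g;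
  ccosP : forall g h, ccos g = ccos h <-> cA (g^-1 * h)%g;
  cSA : forall s, s \in cS -> cA s;
  cS1 : 1%g \in cS;
  cSJ : forall s g, s \in cS -> (s ^ g)%g \in cS;
  cS_span : forall x : 'rV[R]_k, (forall s, s \in cS -> (x *m cw s) 0 0 = 0) -> x = 0;
  c_red : exists M : nat, forall x : 'rV[R]_k, exists2 l : 'rV[R]_k,
    forall a, cA a -> (l *m cw a) 0 0 \is a Num.int &
    forall s, s \in cS -> `|((x - l) *m cw s) 0 0| <= M%:R;
  c_diag : forall n (rho : G -> 'M[Cplx R]_n), is_rep rho ->
    exists (U : 'M[Cplx R]_n) (x : 'I_n -> 'rV[R]_k), unitary U /\
    forall a, cA a -> U *m rho a *m ctrmx U = diag_mx (\row_j expi ((x j *m cw a) 0 0))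
}.

Section Cells.
Variables (R : realType) (G : groupType) (k : nat) (D : crystal R G k).
Local Notation A := (cA D).
Local Notation S := (cS D).
Implicit Types (a b c g h s : G) (x y z l v : 'rV[R]_k).

(** * Characters of the abelian subgroup, lifted to vectors, and the action of the group on them *)

Definition pr a x : R := (x *m cw D a) 0 0.
Definition act g x : 'rV[R]_k := x *m cB D g.

Lemma prD a x y : pr a (x + y) = pr a x + pr a y.
Proof. by rewrite /pr mulmxDl mxE. Qed.
Lemma prN a x : pr a (- x) = - pr a x.
Proof. by rewrite /pr mulNmx mxE. Qed.
Lemma prB a x y : pr a (x - y) = pr a x - pr a y.
Proof. by rewrite prD prN. Qed.
Lemma pr0 a : pr a 0 = 0.
Proof. by rewrite /pr mul0mx mxE. Qed.
Lemma prM a b x : A a -> A b -> pr (a * b)%g x = pr a x + pr b x.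
Proof. by move=> Aa Ab; rewrite /pr cwM// mulmxDr mxE. Qed.
Lemma pr1 x : pr 1%g x = 0.
Proof.
have := prM x (cA1 D) (cA1 D); rewrite mulg1 => /eqP.
by rewrite -subr_eq0 opprD addNKr oppr_eq0 => /eqP.
Qed.
Lemma prV a x : A a -> pr a^-1%g x = - pr a x.
Proof.
move=> Aa; apply/eqP; rewrite -addr_eq0 -prM//; last exact: cAV.
by rewrite mulVg pr1.
Qed.
Lemma pr_act a g x : A a -> pr a (act g x) = pr (a ^ g)%g x.
Proof. by move=> Aa; rewrite /pr /act -mulmxA cBw. Qed.

Lemma actD g x y : act g (x + y) = act g x + act g y.
Proof. exact: mulmxDl. Qed.
Lemma actN g x : act g (- x) = - act g x.
Proof. exact: mulNmx. Qed.
Lemma actB g x y : act g (x - y) = act g x - act g y.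
Proof. by rewrite actD actN. Qed.

(** A [crystal] specifies [cB g] only through its effect on the vectors [cw a], so the action laws
    below are checked on this separating set. *)
Lemma pr_inj x y : (forall s, s \in S -> pr s x = pr s y) -> x = y.
Proof.
move=> h; apply/eqP; rewrite -subr_eq0; apply/eqP; apply: (@cS_span _ _ _ D) => s sS.
by rewrite -/(pr s _) prB h// subrr.
Qed.

Lemma actM g h x : act (g * h)%g x = act g (act h x).
Proof.
apply: pr_inj => s sS; have As := cSA sS.
by rewrite !pr_act// ?conjgM//; exact: cAJ.
Qed.
Lemma act1 x : act 1%g x = x.
Proof. by apply: pr_inj => s sS; rewrite pr_act ?conjg1//; exact: cSA. Qed.
Lemma actK g x : act g^-1%g (act g x) = x.
Proof. by rewrite -actM mulVg act1. Qed.
Lemma act_A a x : A a -> act a x = x.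
Proof.
move=> Aa; apply: pr_inj => s sS; have As := cSA sS; rewrite pr_act//.
by rewrite /conjg (cAC As Aa) mulKg.
Qed.

(** Equality of the characters of [A] defined by [x] and [y]; the lattice appears only through this
    relation. *)
Definition eqv x y := forall a, A a -> pr a (x - y) \is a Num.int.

Lemma eqv_refl x : eqv x x.
Proof. by move=> a _; rewrite subrr pr0. Qed.
Lemma eqv_sym x y : eqv x y -> eqv y x.
Proof. by move=> h a Aa; rewrite -opprB prN rpredN; exact: h. Qed.
Lemma eqv_trans x y z : eqv x y -> eqv y z -> eqv x z.
Proof.
by move=> h1 h2 a Aa; rewrite -(subrK y x) -addrA prD rpredD//; [exact: h1|exact: h2].
Qed.
Lemma eqv_act g x y : eqv x y -> eqv (act g x) (act g y).
Proof. by move=> h a Aa; rewrite -actB pr_act//; apply: h; exact: cAJ. Qed.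

(** Differences are needed, not just [S]: they detect when two translates of a character agree
    ([dirs_stab]) and order the fractional parts of the values on [S] ([cell_rigid]). Since 1 lies
    in [S], they include [S] itself. *)
Definition walls := [seq (s * t^-1)%g | s <- S, t <- S].

Lemma wallsP c : reflect (exists s t, [/\ s \in S, t \in S & c = (s * t^-1)%g]) (c \in walls).
Proof.
apply: (iffP allpairsP) => [[[s t] [? ? ->]]|[s [t [? ? ->]]]]; first by exists s, t.
by exists (s, t).
Qed.

Lemma walls_A c : c \in walls -> A c.
Proof. by move=> /wallsP[s [t [hs ht ->]]]; apply: cAM; [exact: cSA|apply: cAV; exact: cSA]. Qed.
Lemma walls_J c g : c \in walls -> (c ^ g)%g \in walls.
Proof.
move=> /wallsP[s [t [hs ht ->]]]; apply/wallsP; exists (s ^ g)%g, (t ^ g)%g.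
by rewrite conjMg conjVg; split=> //; exact: cSJ.
Qed.
Lemma S_walls s : s \in S -> s \in walls.
Proof. by move=> hs; apply/wallsP; exists s, 1%g; rewrite invg1 mulg1; split=> //; exact: cS1. Qed.
Lemma SS_walls s t : s \in S -> t \in S -> (s * t^-1)%g \in walls.
Proof. by move=> hs ht; apply/wallsP; exists s, t. Qed.

(** Integrality is recorded next to the floor so that points on a wall form cells of their own, of
    lower dimension. *)
Definition same_cell x y := forall c, c \in walls ->
  Num.floor (pr c x) = Num.floor (pr c y) /\
  (pr c x \is a Num.int) = (pr c y \is a Num.int).

Lemma same_cell_refl x : same_cell x x. Proof. by []. Qed.
Lemma same_cell_sym x y : same_cell x y -> same_cell y x.
Proof. by move=> h c cC; have [] := h c cC. Qed.
Lemma same_cell_trans x y z : same_cell x y -> same_cell y z -> same_cell x z.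
Proof. by move=> h1 h2 c cC; have [-> ->] := h1 c cC; exact: h2. Qed.

Lemma same_cell_act g x y : same_cell x y -> same_cell (act g x) (act g y).
Proof.
by move=> h c cC; have Ac := walls_A cC; rewrite !pr_act//; apply: h; exact: walls_J.
Qed.

Lemma same_cell_shift x y l : (forall a, A a -> pr a l \is a Num.int) ->
  same_cell x y -> same_cell (x + l) (y + l).
Proof.
move=> hl h c cC; have [e1 e2] := h c cC; have il := hl c (walls_A cC).
by rewrite !prD !floorDrz// e1 !rpredDr.
Qed.

(** A motion is an element of [G] followed by a lattice translation; both permute the cells, so the
    motion taking [x] to [x'] can be applied to [y]. *)
Lemma same_cell_move x y x' g : same_cell x y -> eqv x' (act g x) ->
  exists2 y', eqv y' (act g y) & same_cell x' y'.
Proof.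
move=> h e; exists (act g y + (x' - act g x)).
  by move=> a Aa; rewrite addrAC subrr add0r; exact: e.
rewrite -[X in same_cell X _](subrK (act g x)) addrC.
by apply: same_cell_shift => //; exact: same_cell_act.
Qed.

Lemma power_in_A g : exists2 m, (0 < m)%N & A (g ^+ m)%g.
Proof.
pose f (i : 'I_(cm D).+1) := ccos D (g ^+ i)%g.
have [i [j [ij e]]] : exists i j : 'I_(cm D).+1, (i < j)%N /\ f i = f j.
  have : ~~ injectiveb f.
    by apply/negP => /injectiveP/leq_card; rewrite !card_ord ltnn.
  move=> /injectivePn[i [j ij e]].
  have [lt|lt|/val_inj eij] := ltngtP i j; last by rewrite eij eqxx in ij.
    by exists i, j.
  by exists j, i.
exists (j - i)%N; first by rewrite subn_gt0.
have /ccosP := e; rewrite -{1}(subnKC (ltnW ij)) expgnDr mulKg//.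
Qed.

(* The fractional parts of [pr (s ^ g^i) x] along the orbit of [s] are compared
   by the walls, so a motion [x -> y] inside a cell makes them monotone in [i];
   being periodic they are constant. *)
Lemma cell_rigid x y g : same_cell x y -> eqv y (act g x) -> y = x.
Proof.
move=> h e; apply: pr_inj => s sS.
pose t i := (s ^ (g ^+ i))%g.
have tS i : t i \in S by exact: cSJ.
pose a i := pr (t i) x - (Num.floor (pr (t i) x))%:~R.
have fl i : Num.floor (pr (t i) x) = Num.floor (pr (t i) y).
  by have [] := h (t i) (S_walls (tS i)).
have aS i : a i.+1 = pr (t i) y - (Num.floor (pr (t i) y))%:~R.
  have := e (t i) (cSA (tS i)); rewrite prB (pr_act g x (cSA (tS i))).
  have -> : (t i ^ g)%g = t i.+1 by rewrite /t expgSr conjgM.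
  move=> hi; rewrite /a; have := floorDrz (pr (t i.+1) x) hi.
  rewrite addrC subrK => ->; move: hi; rewrite intrEfloor => /eqP hi.
  by rewrite intrD hi; ring.
pose c i := (t i.+1 * (t i)^-1)%g.
have cC i : c i \in walls by exact: SS_walls.
have cE i z : pr (c i) z = pr (t i.+1) z - pr (t i) z.
  by rewrite /c prM ?prV//; try apply: cAV; exact: cSA.
pose N i := Num.floor (pr (t i.+1) x) - Num.floor (pr (t i) x).
have up i : a i < a i.+1 -> a i.+1 < a i.+2.
  move=> lt; have [f1 f2] := h _ (cC i).
  have : (N i)%:~R < pr (c i) x by rewrite cE /N intrD intrN; move: lt; rewrite /a; lra.
  move=> /(same_floor_ltr f1 f2); rewrite cE /N intrD intrN !fl !aS; lra.
have down i : a i.+1 < a i -> a i.+2 < a i.+1.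
  move=> lt; have [f1 f2] := h _ (cC i).
  have : pr (c i) x < (N i)%:~R by rewrite cE /N intrD intrN; move: lt; rewrite /a; lra.
  move=> /(same_floor_ltl f1); rewrite cE /N intrD intrN !fl !aS; lra.
have [m m0 Am] := power_in_A g.
have per : a m = a 0.
  have e0 : t m = t 0.
    by rewrite /t expg0 conjg1 /conjg (cAC (cSA sS) Am) mulKg.
  by rewrite /a e0.
have a01 : a 0 = a 1%N.
  have [lt|gt|//] := ltgtP (a 0) (a 1%N).
    have ups i : a i < a i.+1 by elim: i => // i; exact: up.
    have : a 0 < a m.
      by case: (m) m0 => // m' _; elim: m' => // m' ih; exact: lt_trans ih (ups _).
    by rewrite per ltxx.
  have dns i : a i.+1 < a i by elim: i => // i; exact: down.
  have : a m < a 0.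
    by case: (m) m0 => // m' _; elim: m' => // m' ih; exact: lt_trans (dns _) ih.
  by rewrite per ltxx.
move: a01; rewrite aS /a fl /t expg0 conjg1 => /addIr ->//.
Qed.

Lemma pr_actB s g h x : A s -> pr s (act g x - act h x) = pr (s ^ g * (s ^ h)^-1)%g x.
Proof.
move=> As; have Ag : A (s ^ g)%g by exact: cAJ.
have Ah : A (s ^ h)%g by exact: cAJ.
by rewrite prB !pr_act// (prM x Ag (cAV Ah)) (prV x Ah).
Qed.

(** The tangent space of the cell of [x]: directions along which every wall through [x] keeps its
    value. *)
Definition dirs x v := forall c, c \in walls -> pr c x \is a Num.int -> pr c v = 0.

(** If [g x] and [h x] are the same character, the walls [s^g (s^h)^-1] are integral at [x], so they
    vanish on [v]; as [s] runs through [S] this says [g v = h v]. *)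
Lemma dirs_stab x v g h : dirs x v -> eqv (act g x) (act h x) -> act g v = act h v.
Proof.
move=> hv e; apply: pr_inj => s sS; have := e s (cSA sS).
rewrite (pr_actB _ _ _ (cSA sS)) => /(hv _ (SS_walls (cSJ g sS) (cSJ h sS))).
by rewrite -(pr_actB _ _ _ (cSA sS)) prB => /eqP; rewrite subr_eq0 => /eqP.
Qed.

Lemma dirs_cell x y v : same_cell x y -> dirs x v -> dirs y v.
Proof. by move=> h hv c cC; have [_ <-] := h c cC; exact: hv. Qed.

Lemma dirsN x v : dirs x v -> dirs x (- v).
Proof. by move=> hv c cC ci; rewrite prN hv// oppr0. Qed.

Lemma cell_dirs x y : same_cell x y -> dirs x (y - x).
Proof.
move=> h c cC ci; have [fl ei] := h c cC; rewrite prB.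
by rewrite (same_floor_int fl ci) ?subrr// -ei.
Qed.

Definition cell_orbit x y := exists g z, eqv z (act g x) /\ same_cell z y.

Lemma cell_orbit_refl x : cell_orbit x x.
Proof. by exists 1%g, x; rewrite act1; split; [exact: eqv_refl|exact: same_cell_refl]. Qed.

Lemma cell_orbit_sym x y : cell_orbit x y -> cell_orbit y x.
Proof.
move=> [g [z [ez hz]]].
have ex : eqv x (act g^-1%g z) by apply: eqv_sym; rewrite -[X in eqv _ X](actK g x); exact: eqv_act.
have [y' ey hy] := same_cell_move hz ex.
by exists g^-1%g, y'; split=> //; exact: same_cell_sym.
Qed.

(** After a lattice translation the values on [S] are bounded by [M], so those on the walls by [2M];
    a cell is then determined by one of finitely many tables of floors and integrality bits. *)
Lemma cell_orbits_finite : exists m (f : 'I_m -> 'rV[R]_k),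
  (forall i j, cell_orbit (f i) (f j) -> i = j) /\ forall x, exists i, cell_orbit (f i) x.
Proof.
have [M hM] := c_red D.
pose q := size walls.
pose K := {ffun 'I_q -> 'I_(M.*2 + M.*2).+3 * bool}.
apply: (@finite_transversal _ _ #|K| cell_orbit_refl cell_orbit_sym) => m f hf.
have /(@choice _ _)[l hl] : forall i, exists l : 'rV[R]_k,
    (forall a, A a -> pr a l \is a Num.int) /\ forall s, s \in S -> `|pr s (f i - l)| <= M%:R.
  by move=> i; have [l h1 h2] := hM (f i); exists l.
pose r i := f i - l i.
(* The floors lie between [-(2M+1)] and [2M+1], the upper bound excluded; adding [2M+1] makes them
   natural numbers below [4M+3], so [inord] loses nothing. *)
pose key i : K := [ffun j : 'I_q =>
  (inord `|(Num.floor (pr (nth 1%g walls j) (r i)) + (M.*2).+1%:Z)%R|%N,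
   pr (nth 1%g walls j) (r i) \is a Num.int)].
have key_inj : injective key.
  move=> i j /ffunP e; apply: hf.
  have hr : same_cell (r i) (r j).
    move=> c cC; have hi : (index c walls < q)%N by rewrite index_mem.
    have := e (Ordinal hi); rewrite !ffunE /= nth_index// => -[e1 e2]; split=> //.
    have bnd i' : - ((M.*2).+1)%:Z <= Num.floor (pr c (r i')) < ((M.*2).+1)%:Z.
      have hb : `|pr c (r i')| <= (M.*2)%:R.
        have /wallsP[s [t [sS tS ->]]] := cC.
        rewrite (prM _ (cSA sS) (cAV (cSA tS))) (prV _ (cSA tS)).
        apply: le_trans (ler_normB _ _) _; rewrite -addnn natrD lerD//.
          by have [_] := hl i'; apply.
        by have [_] := hl i'; apply.
      apply/andP; split.
        rewrite floor_ge_int;  move: hb; rewrite ler_norml => /andP[hb _].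
        apply: le_trans hb; rewrite intrN lerN2; by rewrite ler_nat.
      rewrite floor_lt_int; move: hb; rewrite ler_norml => /andP[_ hb].
      by apply: (le_lt_trans hb); rewrite ltr_nat.
    have toN i' : exists2 n : nat, (n < (M.*2 + M.*2).+3)%N &
        Num.floor (pr c (r i')) + ((M.*2).+1)%:Z = n%:Z.
      have /andP[b1 b2] := bnd i'.
      exists (absz (Num.floor (pr c (r i')) + ((M.*2).+1)%:Z)%R); last first.
        by rewrite gez0_abs// -lerBlDr add0r.
      rewrite -ltz_nat gez0_abs; last by rewrite -lerBlDr add0r.
      apply: (@lt_le_trans _ _ (((M.*2).+1)%:Z + ((M.*2).+1)%:Z)); first by rewrite ltrD2r.
      by rewrite -PoszD lez_nat addSn addnS.
    have [n1 l1 E1] := toN i; have [n2 l2 E2] := toN j.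
    move: e1; rewrite E1 E2 /= => e1.
    have := congr1 (@nat_of_ord _) e1; rewrite !inordK// => e3.
    by apply: (addIr ((M.*2).+1)%:Z); rewrite E1 E2 e3.
  (* Undo the reduction of [f j] on both reduced points: [r i + l j] is [f i] up to the lattice, and
     lies in the cell of [f j]. *)
  exists 1%g, (r i + l j); rewrite act1; split.
    move=> a Aa; rewrite /r !(prD, prN).
    have -> : pr a (f i) - pr a (l i) + pr a (l j) - pr a (f i) = pr a (l j) - pr a (l i) by ring.
    by rewrite rpredB//; apply: (hl _).1.
  rewrite -[X in same_cell _ X](subrK (l j)).
  by apply: same_cell_shift => //; exact: (hl j).1.
by have := leq_card _ key_inj; rewrite card_ord.
Qed.

End Cells.

(** * Deformation of representations *)

Section DiagMul.
Variable K : pzRingType.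
Lemma diag_mulmxE m n (d : 'rV[K]_m) (M : 'M[K]_(m, n)) i j :
  (diag_mx d *m M) i j = d 0 i * M i j.
Proof. by rewrite mul_diag_mx mxE. Qed.
Lemma mulmx_diagE m n (d : 'rV[K]_n) (M : 'M[K]_(m, n)) i j :
  (M *m diag_mx d) i j = M i j * d 0 j.
Proof. by rewrite mul_mx_diag mxE. Qed.
End DiagMul.

Section Deformation.
Variables (R : realType) (G : groupType) (k : nat) (D : crystal R G k).
Local Notation A := (cA D).
Local Notation C := (Cplx R).
Local Notation pr := (@pr R G k D).
Local Notation act := (@act R G k D).
Local Notation eqv := (@eqv R G k D).
Local Notation dirs := (@dirs R G k D).
Implicit Types (a b g h : G) (x y v w : 'rV[R]_k).

(** * The transfer cocycle *)

Definition coset_act g (q : 'I_(cm D)) : 'I_(cm D) := ccos D (g * crep q)%g.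
(** The defect, lying in [A], of the section [crep] under left multiplication by [g]. *)
Definition coc g (q : 'I_(cm D)) : G := (g * crep q * (crep (coset_act g q))^-1)%g.

Lemma coset_actM g h q : coset_act (g * h) q = coset_act g (coset_act h q).
Proof.
apply/ccosP; rewrite !invgM -!mulgA mulKg.
have := cAV (crepP D (h * crep q)%g).
by rewrite !invgM invgK -!mulgA.
Qed.

Lemma coset_act1 q : coset_act 1 q = q.
Proof. by rewrite /coset_act mul1g crepK. Qed.

Lemma coset_act_inj g : injective (coset_act g).
Proof.
apply: (can_inj (g := coset_act g^-1)) => q.
by rewrite -coset_actM mulVg coset_act1.
Qed.

Lemma coc_A g q : A (coc g q).
Proof.
have := cAJ (crep (coset_act g q))^-1%g (crepP D (g * crep q)%g).
by rewrite -/(coset_act g q) /conjg invgK mulgA mulVKg /coc.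
Qed.

Lemma cocM g h q : coc (g * h) q = (coc h q ^ g^-1 * coc g (coset_act h q))%g.
Proof.
by rewrite /coc coset_actM /conjg invgK -!mulgA mulKg mulKg.
Qed.

Lemma coset_act_A a q : A a -> coset_act a q = q.
Proof.
move=> Aa; rewrite -[RHS]crepK; apply/ccosP.
have := cAJ (crep q) (cAV Aa); by rewrite /conjg invgM -mulgA.
Qed.

Lemma cm_gt0 : (0 < cm D)%N.
Proof. by case: (cm D) (ccos D 1%g) => // -[]. Qed.

(* The transfer cocycle: it extends the additive functions [pr ^~ w] on [A],
   permuted by [G], to a crossed homomorphism on the whole group. *)
Definition phase g w : R := (cm D)%:R^-1 * \sum_q pr (coc g q) (act g w).

(** This is [cocM] summed over the cosets, the terms belonging to [g] being reindexed by the
    permutation that [h] induces. *)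
Lemma phaseM g h w : phase (g * h) w = phase g (act h w) + phase h w.
Proof.
rewrite /phase -mulrDr; congr (_ * _).
rewrite [X in _ = X + _](reindex_inj (@coset_act_inj h)) /= -big_split /=; apply: eq_bigr => q _.
rewrite cocM (prM _ (cAJ _ (coc_A h q)) (coc_A _ _)) addrC actM; congr (_ + _).
by rewrite pr_act ?conjgKV//; apply: cAJ; exact: coc_A.
Qed.

(** An element [a] of [A] fixes every coset and its cocycle value is [a] each time, so dividing by
    the number of cosets gives exactly [pr a]. *)
Lemma phase_A a w : A a -> phase a w = pr a w.
Proof.
move=> Aa; rewrite /phase (eq_bigr (fun=> pr a w)) => [|q _]; last first.
  by rewrite act_A// /coc coset_act_A// mulgK.
rewrite sumr_const card_ord -[X in _ * X]mulr_natl mulrA mulVf ?mul1r//.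
by rewrite pnatr_eq0 -lt0n cm_gt0.
Qed.

Lemma phaseN g w : phase g (- w) = - phase g w.
Proof.
rewrite /phase -mulrN -sumrN; congr (_ * _); apply: eq_bigr => q _.
by rewrite actN prN.
Qed.

Lemma continuous_phase (S : topologicalType) g (f : S -> 'rV[R]_k) s :
  {for s, continuous f} -> {for s, continuous (fun s => phase g (f s))}.
Proof.
move=> cf; apply: continuous_mulR; first exact: cst_continuous.
apply: continuous_Rsum => q.
apply: (@eq_continuous_for _ R (fun s => \sum_i f s 0 i * (cB D g *m cw D (coc g q)) i 0)).
  by move=> u; rewrite /pr /act -mulmxA mxE.
apply: continuous_Rsum => i; apply: continuous_mulR; last exact: cst_continuous.
apply: (@continuous_comp _ _ _ f (fun u : 'rV[R]_k => u 0 i)) => //.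
exact: coord_continuous.
Qed.

Section FixedDim.
Variable n : nat.
Local Notation M := ('M[C]_n).
Implicit Types (rho sigma : G -> M) (t : 'I_n -> G) (z : 'I_n -> 'rV[R]_k) (T : M).

(** * Twisting representations that are diagonal on the abelian subgroup *)

Definition diagonal_on (z : 'I_n -> 'rV[R]_k) rho :=
  forall a, A a -> rho a = diag_mx (\row_j expi (pr a (z j))).

Lemma diagonal_intertwiner z z' rho sigma T i j :
  diagonal_on z rho -> diagonal_on z' sigma ->
  (forall a, A a -> T *m rho a = sigma a *m T) -> T i j != 0 -> eqv (z' i) (z j).
Proof.
move=> hr hs hT Tij a Aa.
have := congr1 (fun N : M => N i j) (hT a Aa); rewrite /= hr// hs//.
rewrite mulmx_diagE diag_mulmxE !mxE mulrC => /(mulIf Tij) h.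
by rewrite prB; apply/expi_eq.
Qed.

(** On [A], the matrix [rho g] intertwines [a |-> rho (a ^ g)], whose characters are the
    [act g (z j)], with [rho] itself. *)
Lemma diagonal_entry z rho g i j : is_rep rho -> diagonal_on z rho ->
  rho g i j != 0 -> eqv (z i) (act g (z j)).
Proof.
move=> hr hz; apply: (@diagonal_intertwiner (fun j => act g (z j)) z (fun a => rho (a ^ g)%g) rho).
- move=> a Aa; rewrite (hz _ (cAJ g Aa)); congr diag_mx; apply/rowP => l.
  by rewrite !mxE pr_act.
- exact: hz.
- by move=> a Aa; rewrite -!hr.2 -conjgC.
Qed.

(** The elements [t j] are kept as data because a displacement [v] of [x] must move the [j]-th
    character by [act (t j) v]. *)
Definition normal_form x t rho := diagonal_on (fun j => act (t j) x) rho.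

Definition twist t v g : M := diag_mx (\row_j expi (phase g (act (t j) v))).
Definition deform t v rho g : M := rho g *m twist t v g.

Lemma twist_unitary t v g : unitary (twist t v g).
Proof.
rewrite /unitary; apply/matrixP => i j; rewrite diag_mulmxE !mxE eq_sym.
case: eqVneq => [->|ne]; first by rewrite mulr1n expi_conj.
by rewrite mulr0n rmorph0 mulr0.
Qed.

(** A nonzero entry of [rho h] at [(i, j)] forces [t i x] and [h t j x] to be the same character,
    hence [t i v = h t j v] by [dirs_stab]. So the twist passes through [rho h], and [phaseM]
    concludes. Only [dirs x v] is assumed, so the endpoint may lie on the boundary of the cell. *)
Lemma deform_rep x t v rho : is_rep rho -> normal_form x t rho -> dirs x v ->
  is_rep (deform t v rho).
Proof.
move=> hr hn hv; split=> [g|g h].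
  by apply: unitaryM; [exact: hr.1|exact: twist_unitary].
have E : twist t v g *m rho h = rho h *m diag_mx (\row_l expi (phase g (act h (act (t l) v)))).
  apply/matrixP => i j; rewrite diag_mulmxE mulmx_diagE !mxE mulrC.
  have [->|ne] := eqVneq (rho h i j) 0; first by rewrite !mul0r.
  congr (_ * expi (phase g _)).
  have := diagonal_entry hr hn ne; rewrite -actM => e.
  by rewrite (dirs_stab hv e) actM.
rewrite /deform hr.2 -!mulmxA [twist t v g *m _]mulmxA E -!mulmxA; congr (_ *m (_ *m _)).
rewrite /twist mulmx_diag; congr diag_mx; apply/rowP => j.
by rewrite !mxE phaseM expiD.
Qed.

Lemma deform_normal x t v rho : normal_form x t rho ->
  normal_form (x + v) t (deform t v rho).
Proof.
move=> hn a Aa; rewrite /deform hn// /twist mulmx_diag; congr diag_mx.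
by apply/rowP => j; rewrite !mxE phase_A// -expiD actD prD.
Qed.

(** The same [T] works: where it has a nonzero entry the two characters agree, hence so do their
    displacements and their phases. *)
Lemma deform_intertwines x t t' v rho sigma T :
  normal_form x t rho -> normal_form x t' sigma -> dirs x v ->
  intertwines rho sigma T -> intertwines (deform t v rho) (deform t' v sigma) T.
Proof.
move=> hr hs hv hT g; rewrite /deform mulmxA hT -!mulmxA; congr (_ *m _).
apply/matrixP => i j; rewrite mulmx_diagE diag_mulmxE !mxE mulrC.
have [->|ne] := eqVneq (T i j) 0; first by rewrite !mulr0.
congr (expi (phase g _) * _).
have e := diagonal_intertwiner hr hs (fun a _ => hT a) ne.
by rewrite (dirs_stab hv e).
Qed.

Lemma deformK t v rho : deform t (- v) (deform t v rho) = rho.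
Proof.
apply/funext => g; rewrite /deform -mulmxA /twist mulmx_diag -[RHS]mulmx1; congr (_ *m _).
rewrite -diag_const_mx; congr diag_mx; apply/rowP => j.
by rewrite !mxE -expiD actN phaseN subrr expi0.
Qed.

Lemma deform_conj x t t' v rho sigma :
  normal_form x t rho -> normal_form x t' sigma -> dirs x v ->
  conj_equiv rho sigma -> conj_equiv (deform t v rho) (deform t' v sigma).
Proof.
move=> hr hs hv /conj_equivP[U uU hU]; apply/conj_equivP; exists U => //.
exact: deform_intertwines hr hs hv hU.
Qed.

Lemma deform_inv_conj x t t' v rho sigma :
  same_cell D x (x + v) -> normal_form x t rho -> normal_form x t' sigma ->
  conj_equiv (deform t v rho) (deform t' v sigma) -> conj_equiv rho sigma.
Proof.
move=> hc hr hs h.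
have hv : dirs (x + v) (- v).
  apply: (dirs_cell hc); apply: dirsN; have := cell_dirs hc.
  by rewrite addrC addKr.
have := deform_conj (deform_normal v hr) (deform_normal v hs) hv h.
by rewrite !deformK.
Qed.

(** Inside the cell the deformation can be reversed by [- v], so a non-scalar self-intertwiner of
    the deformed representation also commutes with the original. *)
Lemma deform_irreducible x t v rho : same_cell D x (x + v) ->
  is_rep rho -> normal_form x t rho -> ~ reducible rho -> ~ reducible (deform t v rho).
Proof.
move=> hc hr hn nr.
have hv' : dirs x v by have := cell_dirs hc; rewrite addrC addKr.
have hv : dirs (x + v) (- v) by apply: (dirs_cell hc); exact: dirsN.
have hd := deform_rep hr hn hv'.
move=> /(reducibleP hd)[T hT nT]; apply: nr; apply/(reducibleP hr); exists T => //.
have := deform_intertwines (deform_normal v hn) (deform_normal v hn) hv hT.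
by rewrite !deformK.
Qed.

(** * Characters occurring in an irreducible representation *)

Definition char_in rho y := exists2 u : 'cV[C]_n, u != 0 &
  forall a, A a -> rho a *m u = expi (pr a y) *: u.

Lemma char_in_conj rho sigma y : conj_equiv rho sigma -> char_in rho y -> char_in sigma y.
Proof.
move=> /conj_equivP[U uU hU] [u u0 hu]; exists (U *m u).
  apply: contra u0 => /eqP e; rewrite -[u]mul1mx -(unitary_mulV uU) -mulmxA e.
  by rewrite mulmx0.
by move=> a Aa; rewrite mulmxA -hU -mulmxA hu// scalemxAr.
Qed.

Lemma char_in_act rho y g : is_rep rho -> char_in rho y -> char_in rho (act g y).
Proof.
move=> hr [u u0 hu]; exists (rho g *m u).
  apply: contra u0 => /eqP e.
  by rewrite -[u]mul1mx -(unitary_mulV (hr.1 g)) -mulmxA e mulmx0.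
move=> a Aa; rewrite mulmxA -hr.2 conjgC hr.2 -mulmxA hu; last exact: cAJ.
by rewrite -scalemxAr pr_act.
Qed.

Lemma eqv_expi y y' a : eqv y y' -> A a -> expi (pr a y) = expi (pr a y').
Proof. by move=> h Aa; apply/expi_eq; rewrite -prB; exact: h. Qed.

Lemma char_in_eqv rho y y' : eqv y y' -> char_in rho y -> char_in rho y'.
Proof.
by move=> e [u u0 hu]; exists u => // a Aa; rewrite -(eqv_expi e Aa) hu.
Qed.

Lemma diagonal_char z rho j : diagonal_on z rho -> char_in rho (z j).
Proof.
move=> hz; exists (delta_mx j 0).
  by apply/eqP => /matrixP/(_ j 0); rewrite !mxE !eqxx => /eqP; rewrite oner_eq0.
move=> a Aa; apply/matrixP => i l; rewrite hz// diag_mulmxE !mxE.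
by case: eqVneq => [->|]//=; rewrite !mulr0.
Qed.

Lemma char_in_diagonal z rho y : diagonal_on z rho -> char_in rho y ->
  exists j, eqv (z j) y.
Proof.
move=> hz [u u0 hu].
have [j uj] : exists j, u j 0 != 0.
  apply: contrapT => h; move/negP: u0; apply; apply/eqP/matrixP => i j; rewrite mxE ord1.
  by apply/eqP/negPn/negP => hij; apply: h; exists i.
exists j => a Aa; have := congr1 (fun N : 'cV[C]_n => N j 0) (hu a Aa).
rewrite /= hz// diag_mulmxE !mxE => /(mulIf uj) h; rewrite prB; exact/expi_eq.
Qed.

Lemma exists_diagonal rho : is_rep rho ->
  exists sigma z, [/\ conj_equiv rho sigma, is_rep sigma & diagonal_on z sigma].
Proof.
move=> hr; have [U [z [uU hU]]] := c_diag D hr.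
have hc : conj_equiv rho (fun g => U *m rho g *m ctrmx U) by exists U.
by exists (fun g => U *m rho g *m ctrmx U), z; split=> //; exact: conj_rep hr.
Qed.

Lemma exists_char rho : (0 < n)%N -> is_rep rho -> exists y, char_in rho y.
Proof.
move=> n0 hr; have [sigma [z [hc _ hz]]] := exists_diagonal hr.
exists (z (Ordinal n0)); apply: char_in_conj (conj_equiv_sym hc) _.
exact: diagonal_char.
Qed.

(** The projection [P] onto the coordinates whose character lies in the orbit of [y] commutes with
    the representation, so it is scalar by Schur; its entry at [j0] is 1, so every coordinate
    belongs to the orbit. *)
Lemma exists_normal_form rho y : is_rep rho -> ~ reducible rho -> char_in rho y ->
  exists sigma t j0, [/\ conj_equiv rho sigma, is_rep sigma, normal_form y t sigma & t j0 = 1%g].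
Proof.
move=> hr nr hy; have [sigma [z [hc hs hz]]] := exists_diagonal hr.
have [j0 ej0] := char_in_diagonal hz (char_in_conj hc hy).
pose O j := `[< exists g, eqv (z j) (act g y) >].
pose P : M := diag_mx (\row_j (O j)%:R).
have hP : intertwines sigma sigma P.
  move=> g; apply/matrixP => i j; rewrite mulmx_diagE diag_mulmxE !mxE mulrC.
  have [->|ne] := eqVneq (sigma g i j) 0; first by rewrite !mul0r.
  have e := diagonal_entry hs hz ne.
  congr (_ * (nat_of_bool _)%:R); apply/asboolP/asboolP => -[h eh].
    exists (g^-1 * h)%g; rewrite actM -(actK D g (z j)); apply: eqv_act.
    by apply: eqv_trans eh; exact: eqv_sym.
  by exists (g * h)%g; rewrite actM; apply: eqv_trans e _; exact: eqv_act.
have ns : ~ reducible sigma by move=> /(reducible_conj (conj_equiv_sym hc)).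
have [c cE] := schur hs ns hP.
have entry j : (O j)%:R = c.
  by have := congr1 (fun N : M => N j j) cE; rewrite /= !mxE eqxx !mulr1n.
have O0 : O j0 by apply/asboolP; exists 1%g; rewrite act1.
have Oall j : exists g, eqv (z j) (act g y).
  apply/asboolP; rewrite -/(O j); have := entry j; rewrite -(entry j0) O0.
  by case: (O j) => // /eqP; rewrite eq_sym oner_eq0.
have [t ht] := choice Oall.
(* The choice at [j0] is reset to 1, so that this coordinate carries [y] itself. *)
exists sigma, (fun j => if j == j0 then 1%g else t j), j0; split=> //; last by rewrite eqxx.
move=> a Aa; rewrite hz//; congr diag_mx; apply/rowP => j; rewrite !mxE.
apply: eqv_expi => //; case: eqVneq => [->|_]; last exact: ht.
by rewrite act1.
Qed.

Lemma irreducible_chars rho y y' : is_rep rho -> ~ reducible rho ->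
  char_in rho y -> char_in rho y' -> exists g, eqv y' (act g y).
Proof.
move=> hr nr hy hy'.
have [sigma [t [j0 [hc hs hn tj]]]] := exists_normal_form hr nr hy.
have [j ej] := char_in_diagonal hn (char_in_conj hc hy').
by exists (t j); exact: eqv_sym.
Qed.

(** Averaging over the cosets of [A] suffices since [E] already commutes with [A]: each summand is
    independent of the coset representative. *)
Lemma averaged_intertwiner rho sigma (E : M) : is_rep rho -> is_rep sigma ->
  (forall a, A a -> sigma a *m E = E *m rho a) ->
  intertwines rho sigma (\sum_(q < cm D) sigma (crep q) *m E *m ctrmx (rho (crep q))).
Proof.
move=> hr hs hE g; rewrite mulmx_suml mulmx_sumr.
rewrite (reindex_inj (@coset_act_inj g)) /=; apply: eq_bigr => q _.
pose r := crep (coset_act g q).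
pose b := (r^-1 * g * crep q)%g.
have Ab : A b by have := crepP D (g * crep q)%g; rewrite mulgA.
have e1 : (g * crep q = r * b)%g by rewrite /b -!mulgA mulVKg.
have e2 : (r^-1 * g = b * (crep q)^-1)%g by rewrite /b mulgK.
rewrite -/r -repV// -mulmxA -hr.2 e2 hr.2 repV//.
rewrite !mulmxA -hs.2 e1 hs.2; congr (_ *m _).
by rewrite -!mulmxA hE.
Qed.

(** [f_t1] marks a coordinate on which [A] acts by [x] itself, so that matrix coefficients of
    different representations over [x] can be compared. *)
Record framed (x : 'rV[R]_k) := Framed {
  f_rho : G -> M; f_t : 'I_n -> G; f_j : 'I_n;
  f_rep : is_rep f_rho; f_irr : ~ reducible f_rho;
  f_normal : normal_form x f_t f_rho; f_t1 : f_t f_j = 1%g }.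

(** Schur orthogonality over the cosets of [A]. The elementary matrix joining the marked coordinates
    commutes with [A], as both carry [x]; its average is an intertwiner, hence zero, and the sum is
    one of its entries. *)
Lemma framed_orthogonal x (F H : framed x) : ~ conj_equiv (f_rho H) (f_rho F) ->
  \sum_(q < cm D) f_rho F (crep q) (f_j F) (f_j F) *
    Num.conj (f_rho H (crep q) (f_j H) (f_j H)) = 0.
Proof.
move=> nc; pose E : M := delta_mx (f_j F) (f_j H).
have hE a : A a -> f_rho F a *m E = E *m f_rho H a.
  move=> Aa; apply/matrixP => i j; rewrite (f_normal F Aa) (f_normal H Aa).
  rewrite diag_mulmxE mulmx_diagE !mxE mulrC.
  case: eqVneq => [->|_] /=; last by rewrite !mul0r.
  case: eqVneq => [->|_] /=; last by rewrite !mul0r.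
  by rewrite !f_t1.
have hT := averaged_intertwiner (f_rep H) (f_rep F) hE.
move: hT; set T := \sum_q _ => hT.
have T0 : T = 0.
  apply/eqP; apply: contrapT => /negP T0; apply: nc.
  exact: intertwiner_conj (f_rep H) (f_rep F) (@f_irr _ F) hT T0.
have := congr1 (fun N : M => N (f_j F) (f_j H)) T0; rewrite /= mxE /T summxE => h.
rewrite -[RHS]h; apply: eq_bigr => q _.
rewrite mxE (bigD1 (f_j H))//= big1 ?addr0 => [|j ne]; last first.
  rewrite mxE big1 ?mul0r// => l _; rewrite !mxE.
  by rewrite (negbTE ne) andbF mulr0.
rewrite !mxE (bigD1 (f_j F))//= big1 ?addr0 => [|j ne]; last first.
  by rewrite !mxE (negbTE ne) mulr0.
by rewrite !mxE !eqxx mulr1.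
Qed.

(** Pairwise inequivalent representations over [x] give orthogonal nonzero rows indexed by the
    cosets of [A], so there are at most [cm D] of them. *)
Lemma framed_finite x : exists m (f : 'I_m -> framed x),
  (forall i j, conj_equiv (f_rho (f i)) (f_rho (f j)) -> i = j) /\
  forall F : framed x, exists i, conj_equiv (f_rho (f i)) (f_rho F).
Proof.
apply: (@finite_transversal (framed x) (fun F H => conj_equiv (f_rho F) (f_rho H)) (cm D)).
- by move=> F; exact: conj_equiv_refl.
- by move=> F H; exact: conj_equiv_sym.
move=> m f hf.
pose N : 'M[C]_(m, cm D) := \matrix_(i, q) f_rho (f i) (crep q) (f_j (f i)) (f_j (f i)).
pose d : 'rV[C]_m := \row_i \sum_q N i q * Num.conj (N i q).
have NN : N *m (map_mx Num.conj N)^T = diag_mx d.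
  apply/matrixP => i j; rewrite !mxE; case: eqVneq => [->|ne].
    by rewrite mulr1n; apply: eq_bigr => q _; rewrite !mxE.
  rewrite mulr0n -[RHS](@framed_orthogonal x (f i) (f j)).
    by apply: eq_bigr => q _; rewrite !mxE.
  by move=> /hf e; move: ne; rewrite e eqxx.
(* The row is nonzero at the coset of 1: its representative lies in [A], where the marked entry is a
   value of [expi]. *)
have d0 i : d 0 i != 0.
  rewrite mxE gt_eqF// (bigD1 (ccos D 1%g))//= ltr_wpDr//.
    by rewrite sumr_ge0// => q _; rewrite mul_conjC_ge0.
  rewrite mul_conjC_gt0 mxE (f_normal (f i)); last first.
    by have := cAV (crepP D 1%g); rewrite mulg1 invgK.
  by rewrite !mxE eqxx mulr1n expi_neq0.
have : \rank (diag_mx d) = m.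
  by apply: mxrank_unit; rewrite unitmxE det_diag unitfE; apply/prodf_neq0 => i _.
move=> <-; rewrite -NN; apply: leq_trans (mxrankM_maxl _ _) _.
exact: rank_leq_col.
Qed.

End FixedDim.
End Deformation.

(** * Closed cells as images of disks *)

Section CellDimension.
Variables (R : realType) (G : groupType) (k : nat) (D : crystal R G k).
Local Notation walls := (walls D).
Local Notation pr := (@pr R G k D).
Local Notation act := (@act R G k D).
Implicit Types (x y v : 'rV[R]_k).

(** Walls not passing through [x] contribute a zero column, so the left kernel is the tangent space
    [dirs x]. *)
Definition wall_mx x : 'M[R]_(k, size walls) :=
  \matrix_(i, j) if pr (nth 1%g walls j) x \is a Num.int then cw D (nth 1%g walls j) i 0 else 0.
Definition cdim x := \rank (kermx (wall_mx x)).
Definition cbasis x : 'M[R]_(cdim x, k) := row_base (kermx (wall_mx x)).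

Lemma dirsP x v : dirs D x v <-> (v <= kermx (wall_mx x))%MS.
Proof.
rewrite -(rwP sub_kermxP); split=> h.
  apply/rowP => j; rewrite !mxE; set c := nth 1%g walls j.
  have cC : c \in walls by exact: mem_nth.
  have [ci|nci] := boolP (pr c x \is a Num.int); last first.
    by rewrite big1// => i _; rewrite mxE (negbTE nci) mulr0.
  rewrite -[RHS](h c cC ci) /pr mxE; apply: eq_bigr => i _.
  by rewrite mxE -/c ci.
move=> c cC ci; have jc : (index c walls < size walls)%N by rewrite index_mem.
have /rowP/(_ (Ordinal jc)) := h; rewrite !mxE => <-; rewrite /pr mxE.
by apply: eq_bigr => i _; rewrite mxE /= nth_index// ci.
Qed.

Lemma cdim_le_k x : (cdim x <= k)%N.
Proof. exact: rank_leq_row. Qed.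

Lemma cbasis_dirs x (u : 'rV[R]_(cdim x)) : dirs D x (u *m cbasis x).
Proof. by apply/dirsP; apply: submx_trans (submxMl _ _) _; rewrite eq_row_base. Qed.

Lemma dirs_cbasis x v : dirs D x v -> exists u : 'rV[R]_(cdim x), v = u *m cbasis x.
Proof. by move=> /dirsP; rewrite -(eq_row_base (kermx _)) => /submxP[u ->]; exists u. Qed.

Lemma cbasis_inj x (u w : 'rV[R]_(cdim x)) : u *m cbasis x = w *m cbasis x -> u = w.
Proof. exact/row_free_inj/row_base_free. Qed.

Lemma act_row_free g : row_free (cB D g).
Proof.
apply/row_freeP; exists (cB D g^-1%g); apply/row_matrixP => i.
by rewrite -[RHS](actK D g) /act -!row_mul mul1mx.
Qed.

Lemma cdim_le x y g : (forall v, dirs D x v -> dirs D y (act g v)) -> (cdim x <= cdim y)%N.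
Proof.
move=> h; rewrite /cdim -(mxrankMfree _ (act_row_free g)); apply: mxrankS.
apply/row_subP => i; rewrite row_mul; apply/dirsP; apply: h; apply/dirsP.
exact: row_sub.
Qed.

Lemma cdim_cell x y : same_cell D x y -> cdim x = cdim y.
Proof.
move=> h; apply/eqP; rewrite eqn_leq; apply/andP; split; apply: (@cdim_le _ _ 1%g) => v hv;
  rewrite act1; apply: dirs_cell hv => //; exact: same_cell_sym.
Qed.

Lemma cdim_eqv_act x y g : eqv D y (act g x) -> cdim x = cdim y.
Proof.
have le x' y' g' : eqv D y' (act g' x') -> (cdim x' <= cdim y')%N.
  move=> e; apply: (@cdim_le _ _ g') => v hv c cC ci.
  rewrite (pr_act _ _ (walls_A cC)).
  apply: hv; first exact: walls_J.
  have := e c (walls_A cC); rewrite prB (pr_act _ _ (walls_A cC)).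
  by move=> ei; rewrite -(subKr (pr c y') (pr (c ^ g')%g x')) rpredB.
move=> e; apply/eqP; rewrite eqn_leq (le _ _ _ e) (le y x g^-1%g)//.
by apply: eqv_sym; rewrite -[X in eqv _ _ X](actK D g x); exact: eqv_act.
Qed.

(** The directions at [y] are among those at [x], and [y - x] is lost because it changes the value
    of [c0]. *)
Lemma cdim_lt x y c0 : (forall c, c \in walls -> pr c x \is a Num.int -> pr c y \is a Num.int) ->
  dirs D x (y - x) -> c0 \in walls -> pr c0 x \isn't a Num.int -> pr c0 y \is a Num.int ->
  (cdim y < cdim x)%N.
Proof.
move=> h hv cC nx iy; apply: rank_ltmx; rewrite ltmxE; apply/andP; split.
  apply/row_subP => i; apply/dirsP => c cC' ci.
  have /dirsP hr : (row i (kermx (wall_mx y)) <= kermx (wall_mx y))%MS by exact: row_sub.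
  by apply: hr => //; exact: h.
apply/negP => le; have /dirsP le' := hv.
have /dirsP/(_ _ cC iy) := submx_trans le' le.
rewrite prB => /eqP; rewrite subr_eq0 => /eqP e.
by move: nx; rewrite -e iy.
Qed.

(** * A cell as a bounded polytope in its tangent space *)

Section Polytope.
Variable x : 'rV[R]_k.

(** The value of a wall off [x] stays strictly between two consecutive integers on the cell. The
    boolean selects the upper or lower one, and dividing by its signed distance from the value at
    [x] turns either bound into [< 1]. Walls through [x] give the zero form. *)
Definition facet (jb : 'I_(size walls) * bool) : 'cV[R]_(cdim x) :=
  let c := nth 1%g walls jb.1 in
  if pr c x \is a Num.int then 0
  else ((Num.floor (pr c x))%:~R + jb.2%:R - pr c x)^-1 *: (cbasis x *m cw D c).

Lemma facetE (u : 'rV[R]_(cdim x)) c b (cC : (index c walls < size walls)%N) :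
  c \in walls -> pr c x \isn't a Num.int ->
  (u *m facet (Ordinal cC, b)) 0 0 =
    ((Num.floor (pr c x))%:~R + b%:R - pr c x)^-1 * pr c (u *m cbasis x).
Proof.
by move=> hc nc; rewrite /facet /= nth_index// (negbTE nc) -scalemxAr mxE mulmxA.
Qed.

Lemma frac_bounds r : r \isn't a Num.int ->
  (Num.floor r)%:~R < r :> R /\ r < (Num.floor r)%:~R + 1 :> R.
Proof.
move=> nr; split; last by rewrite -[X in _ + X]/(1%:~R) -intrD lt_succ_floor.
by rewrite lt_neqAle ge_floor andbT -intrEfloor.
Qed.

(** Boundedness of the polytope: a nonzero direction changes some [pr s] with [s] in [S], which is
    itself a wall, bounded on both sides. *)
Lemma facet_pos (u : 'rV[R]_(cdim x)) : u != 0 -> exists jb, 0 < (u *m facet jb) 0 0.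
Proof.
move=> u0; pose v := u *m cbasis x.
have [s sS sv] : exists2 s, s \in cS D & pr s v != 0.
  apply: contrapT => h; move/negP: u0; apply; apply/eqP/(@cbasis_inj x).
  rewrite mul0mx; apply: (@pr_inj _ _ _ D) => s sS; rewrite pr0.
  by apply/eqP/negPn/negP => hs; apply: h; exists s.
have sC := S_walls sS.
have ns : pr s x \isn't a Num.int.
  by apply/negP => si; move/eqP: sv; apply; exact: (@cbasis_dirs x u).
have js : (index s walls < size walls)%N by rewrite index_mem.
have [b1 b2] := frac_bounds ns.
have [lt|gt|e] := ltgtP (pr s v) 0; last by rewrite e eqxx in sv.
  exists (Ordinal js, false); rewrite facetE// nmulr_rgt0// invr_lt0 addr0.
  by rewrite subr_lt0.
exists (Ordinal js, true); rewrite facetE// pmulr_rgt0// invr_gt0.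
by rewrite subr_gt0.
Qed.

Lemma facet_cell (u : 'rV[R]_(cdim x)) :
  (forall jb, (u *m facet jb) 0 0 < 1) <-> same_cell D x (x + u *m cbasis x).
Proof.
split=> h.
  move=> c cC; rewrite prD.
  have jc : (index c walls < size walls)%N by rewrite index_mem.
  have [ci|nc] := boolP (pr c x \is a Num.int).
    by rewrite (cbasis_dirs u cC ci) addr0 ci.
  have [b1 b2] := frac_bounds nc.
  have := h (Ordinal jc, true); rewrite facetE// mulrC ltr_pdivrMr ?subr_gt0// mul1r mulr1n => h1.
  have := h (Ordinal jc, false); rewrite facetE// mulrC ltr_ndivrMr ?addr0 ?subr_lt0// mul1r => h2.
  have fl : Num.floor (pr c x + pr c (u *m cbasis x)) = Num.floor (pr c x).
    apply: floor_def; rewrite intrD; apply/andP; split; first lra.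
    by rewrite -[1%:~R]/(1 : R); lra.
  split; first by rewrite fl.
  apply/esym/negbTE/negP; rewrite intrEfloor fl => /eqP e; lra.
move=> [j b]; pose c := nth 1%g walls j.
have cC : c \in walls by exact: mem_nth.
have [fl ei] := h c cC; rewrite prD in fl ei.
have [ci|nc] := boolP (pr c x \is a Num.int).
  by rewrite /facet /= -/c ci mulmx0 mxE.
have -> : (u *m facet (j, b)) 0 0 =
    ((Num.floor (pr c x))%:~R + b%:R - pr c x)^-1 * pr c (u *m cbasis x).
  by rewrite /facet /= -/c (negbTE nc) -scalemxAr mxE mulmxA.
have [b1 b2] := frac_bounds nc.
have [b3 b4] : (Num.floor (pr c x))%:~R < pr c x + pr c (u *m cbasis x) /\
     pr c x + pr c (u *m cbasis x) < (Num.floor (pr c x))%:~R + 1.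
  by rewrite fl; apply: frac_bounds; rewrite -ei.
case: b; rewrite mulrC.
  by rewrite ltr_pdivrMr ?subr_gt0// mul1r mulr1n; lra.
by rewrite ltr_ndivrMr ?addr0 ?subr_lt0// mul1r; lra.
Qed.

(** Reaching the bound makes a new wall integral, while the walls through [x] stay so. *)
Lemma facet_boundary (u : 'rV[R]_(cdim x)) jb : (u *m facet jb) 0 0 = 1 ->
  (cdim (x + u *m cbasis x) < cdim x)%N.
Proof.
case: jb => j b; pose c := nth 1%g walls j.
have cC : c \in walls by exact: mem_nth.
have [ci|nc] := boolP (pr c x \is a Num.int).
  by rewrite /facet /= -/c ci mulmx0 mxE => /eqP; rewrite eq_sym oner_eq0.
have -> : (u *m facet (j, b)) 0 0 =
    ((Num.floor (pr c x))%:~R + b%:R - pr c x)^-1 * pr c (u *m cbasis x).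
  by rewrite /facet /= -/c (negbTE nc) -scalemxAr mxE mulmxA.
have [b1 b2] := frac_bounds nc => h.
have d0 : (Num.floor (pr c x))%:~R + b%:R - pr c x != 0.
  by case: b {h}; [rewrite gt_eqF// subr_gt0|rewrite lt_eqF// addr0 subr_lt0].
have e : pr c (u *m cbasis x) = (Num.floor (pr c x))%:~R + b%:R - pr c x.
  by rewrite -[LHS]mul1r -[X in X * _](divff d0) -mulrA h mulr1.
apply: (@cdim_lt x _ c) => //.
- by move=> c' cC' ci'; rewrite prD (cbasis_dirs u cC' ci') addr0.
- by rewrite addrC addKr; exact: cbasis_dirs.
- by rewrite prD e addrC subrK rpredD// ?rpred_int// rpred_nat.
Qed.

Definition disk_map := projT1 (cid (disk_onto_polytope facet_pos)).

Lemma disk_mapP :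
  [/\ forall u, cdisk u -> {for u, continuous disk_map},
      forall u, odisk u -> forall j, (disk_map u *m facet j) 0 0 < 1,
      forall w : 'rV[R]_(cdim x), (forall j, (w *m facet j) 0 0 < 1) ->
        exists2 u, odisk u & disk_map u = w,
      forall u w, odisk u -> odisk w -> disk_map u = disk_map w -> u = w &
      forall u, bsphere u -> (forall j, (disk_map u *m facet j) 0 0 <= 1) /\
                          exists j, (disk_map u *m facet j) 0 0 = 1].
Proof. exact: projT2 (cid (disk_onto_polytope facet_pos)). Qed.

End Polytope.
End CellDimension.

(** * The CW structure *)

Section Assembly.
Variables (R : realType) (G : groupType) (k n : nat) (D : crystal R G k).
Hypothesis n_gt0 : (0 < n)%N.
Local Notation C := (Cplx R).
Local Notation M := ('M[C]_n).
Local Notation X := (IrrPlus R G n).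
Local Notation pr := (@pr R G k D).
Local Notation act := (@act R G k D).
Local Notation framed := (@framed R G k D n).
Local Notation dmap := (@disk_map R G k D).

Definition hom_pt (rho : G -> M) (hr : is_rep rho) : HomSp R G n :=
  exist _ (rho : {ptws G -> M}) (mem_set hr).
Definition irr_pt (rho : HomSp R G n) : X := qpi _ (existT (plus_pt_fam (HomSp R G n)) true rho).
Definition base_pt : X := qpi _ (existT (plus_pt_fam (HomSp R G n)) false tt).

Lemma qpi_irr (x y : plus_pt (HomSp R G n)) :
  qpi (@irr_rel R G n) x = qpi (@irr_rel R G n) y <-> irr_rel x y.
Proof.
by apply: qpi_eq; [exact: irr_rel_refl|exact: irr_rel_sym|exact: irr_rel_trans].
Qed.

Lemma irr_pt_eq (rho sigma : HomSp R G n) : ~ reducible (val rho : G -> M) ->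
  irr_pt rho = irr_pt sigma -> conj_equiv (val rho : G -> M) (val sigma).
Proof. by move=> nr /qpi_irr[[]//|[a [b [[<-] [<-]]]]]. Qed.

Lemma conj_irr_pt (rho sigma : HomSp R G n) :
  conj_equiv (val rho : G -> M) (val sigma) -> irr_pt rho = irr_pt sigma.
Proof. by move=> h; apply/qpi_irr; right; exists rho, sigma. Qed.

Lemma irr_pt_base (rho : HomSp R G n) :
  irr_pt rho = base_pt <-> reducible (val rho : G -> M).
Proof.
split; first by move=> /qpi_irr[[]//|[a [b [_]]]].
by move=> h; apply/qpi_irr; left.
Qed.

Lemma point_cases (c : X) : c = base_pt \/ exists rho : HomSp R G n, c = irr_pt rho.
Proof.
have [[[] v] ->] := qpi_surj c; first by right; exists v.
by left; case: v.
Qed.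

(** Every displacement along [cbasis] is parallel to the cell, so this is a representation for all
    [u], the boundary sphere included. *)
Definition cell_rep x (F : framed x) (u : 'rV[R]_(cdim D x)) : HomSp R G n :=
  hom_pt (deform_rep (f_rep F) (f_normal F) (cbasis_dirs (dmap u))).

Lemma val_cell_rep x (F : framed x) u :
  val (cell_rep F u) = deform D (f_t F) (dmap u *m cbasis D x) (f_rho F) :> (G -> M).
Proof. by []. Qed.

Lemma continuous_rVM (S : topologicalType) m p (f : S -> 'rV[R]_m) (N : 'M[R]_(m, p)) s :
  {for s, continuous f} -> {for s, continuous (fun s => f s *m N)}.
Proof.
move=> cf; apply: continuous_to_mx => i j.
apply: (@eq_continuous_for _ R (fun s => \sum_l f s 0 l * N l j)).
  by move=> r; rewrite mxE ord1.
apply: continuous_Rsum => l; apply: continuous_mulR; last exact: cst_continuous.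
apply: (@continuous_comp _ _ _ f (fun u : 'rV[R]_m => u 0 l)) => //.
exact: coord_continuous.
Qed.

Lemma continuous_cell_rep x (F : framed x) (u : 'rV[R]_(cdim D x)) :
  cdisk u -> {for u, continuous (fun u => irr_pt (cell_rep F u))}.
Proof.
move=> cu; have [ch _ _ _ _] := disk_mapP D x.
apply: (@continuous_comp _ _ _
  (fun u => existT (plus_pt_fam (HomSp R G n)) true (cell_rep F u)) (qpi _)); last exact: continuous_qpi.
apply: (@continuous_comp _ _ _
  (fun u => cell_rep F u) (existT (plus_pt_fam (HomSp R G n)) true)); last exact: existT_continuous.
apply: continuous_to_set_type; apply: continuous_to_ptws => g.
apply: continuous_to_mx => i j.
apply: (@eq_continuous_for _ C (fun u =>
  f_rho F g i j * expi (phase D g (act (f_t F j) (dmap u *m cbasis D x))))).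
  by move=> w; rewrite val_cell_rep /deform mulmx_diagE mxE.
apply: continuous_mulf; first exact: cst_continuous.
apply: (@continuous_comp _ _ _
  (fun u => phase D g (act (f_t F j) (dmap u *m cbasis D x))) (@expi R)); last exact: continuous_expi.
apply: continuous_phase; apply: continuous_rVM; apply: continuous_rVM.
exact: ch.
Qed.

Section Cells.
Variables (P : nat) (pt : 'I_P -> 'rV[R]_k) (N : 'I_P -> nat)
  (fr : forall p, 'I_(N p) -> framed (pt p)).
Hypothesis pt_inj : forall i j, cell_orbit D (pt i) (pt j) -> i = j.
Hypothesis pt_surj : forall x, exists i, cell_orbit D (pt i) x.
Hypothesis fr_inj : forall p (i j : 'I_(N p)), conj_equiv (f_rho (fr i)) (f_rho (fr j)) -> i = j.
Hypothesis fr_surj : forall p (F : framed (pt p)),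
  exists i : 'I_(N p), conj_equiv (f_rho (fr i)) (f_rho F).

(** [None] is the basepoint, a 0-cell; [Some] pairs an orbit of cells with a class of irreducible
    representations over its reference point. *)
Definition cell_index := option {p : 'I_P & 'I_(N p)}.
Definition cell_dim (i : cell_index) : nat :=
  if i is Some s then cdim D (pt (tag s)) else 0%N.
Definition cell_map (i : cell_index) : 'rV[R]_(cell_dim i) -> X :=
  match i return 'rV[R]_(cell_dim i) -> X with
  | Some s => fun u => irr_pt (cell_rep (fr (tagged s)) u)
  | None => fun _ => base_pt
  end.

Lemma disk_map_in_cell x (u : 'rV[R]_(cdim D x)) : odisk u ->
  same_cell D x (x + dmap u *m cbasis D x).
Proof. by move=> ou; apply/facet_cell; have [_ h _ _ _] := disk_mapP D x; exact: h. Qed.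

Lemma cell_rep_irreducible x (F : framed x) u : odisk u ->
  ~ reducible (val (cell_rep F u) : G -> M).
Proof.
move=> ou; rewrite val_cell_rep; apply: deform_irreducible; last exact: f_irr.
- exact: disk_map_in_cell.
- exact: f_rep.
- exact: f_normal.
Qed.

Lemma cell_rep_char x (F : framed x) u :
  char_in D (val (cell_rep F u) : G -> M) (x + dmap u *m cbasis D x).
Proof.
have := diagonal_char (f_j F) (deform_normal (dmap u *m cbasis D x) (f_normal F)).
by rewrite f_t1 act1.
Qed.

(** Move [y] by [G] and the lattice to a point [z] in a reference cell, deform back from [z] to the
    reference point, identify the result with one of the [fr], and deform forward again. Recording
    the dimension at [y] is what places boundary points in lower cells. *)
Lemma irreducible_covered (rho : HomSp R G n) y :
  ~ reducible (val rho : G -> M) -> char_in D (val rho : G -> M) y ->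
  exists (s : {p : 'I_P & 'I_(N p)}) u, [/\ cdim D (pt (tag s)) = cdim D y, odisk u &
    irr_pt (cell_rep (fr (tagged s)) u) = irr_pt rho].
Proof.
move=> nr hy; have hr : is_rep (val rho : G -> M) by exact: set_mem (valP rho).
have [p /cell_orbit_sym[g [z [ez hz]]]] := pt_surj y.
pose x := pt p; rewrite -/x in hz.
have dxy : cdim D x = cdim D y by rewrite (cdim_eqv_act ez) (cdim_cell hz).
have hcz : char_in D (val rho : G -> M) z.
  by apply: char_in_eqv (eqv_sym ez) _; exact: char_in_act.
have [sigma [t [j0 [hc hs hn tj]]]] := exists_normal_form hr nr hcz.
have ns : ~ reducible sigma by move=> /(reducible_conj (conj_equiv_sym hc)).
pose v := z - x.
have zv : z + - v = x by rewrite /v opprB addrC subrK.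
have xv : x + v = z by rewrite /v addrC subrK.
have hzv : same_cell D z (z + - v) by rewrite zv.
have hdz : dirs D z (- v).
  by have := cell_dirs hz; rewrite /v opprB.
have hn' : normal_form D x t (deform D t (- v) sigma).
  by have := deform_normal (- v) hn; rewrite zv.
pose F := @Framed R G k D n x _ t j0 (deform_rep hs hn hdz)
  (deform_irreducible hzv hs hn ns) hn' tj.
have [i hi] := @fr_surj p F.
have hxv : same_cell D x (x + v) by rewrite xv; exact: same_cell_sym.
have hdx : dirs D x v by have := cell_dirs hxv; rewrite addrC addKr.
have [w wE] := dirs_cbasis hdx.
have [_ _ surj _ _] := disk_mapP D x.
have [|u ou uw] := surj w; first by apply/facet_cell; rewrite -wE.
exists (Tagged (fun p => 'I_(N p)) i), u; split=> //.
apply: conj_irr_pt; rewrite val_cell_rep /=.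
have -> : dmap u *m cbasis D (pt p) = v by rewrite uw wE.
have := deform_conj (f_normal (fr i)) (f_normal F) hdx hi.
rewrite /= => h; apply: conj_equiv_trans h _.
by rewrite -{1}(opprK v) deformK; exact: conj_equiv_sym.
Qed.

Lemma cells_CW : CW_dim_le R X k.
Proof.
apply: (@finite_CW R X k cell_index cell_dim cell_map).
- exact: hausdorff_IrrPlus.
- by case=> [s|] //=; exact: cdim_le_k.
- case=> [s|] v cv; last exact: cst_continuous.
  exact: continuous_cell_rep.
- move=> c; have [->|[rho ->]] := point_cases c.
    exists None, 0; split=> //; rewrite /odisk /= /sqnorm big_ord0; exact: ltr01.
  have [rr|nr] := pselect (reducible (val rho : G -> M)).
    exists None, 0; split; first by rewrite /odisk /= /sqnorm big_ord0; exact: ltr01.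
    by apply/esym/irr_pt_base.
  have hr : is_rep (val rho : G -> M) by exact: set_mem (valP rho).
  have [y hy] := exists_char D n_gt0 hr.
  have [s [u [_ ou e]]] := irreducible_covered nr hy.
  by exists (Some s), u.
- move=> [[p i]|] [[p' i']|] u u' ou ou' //= e.
  + have nr := @cell_rep_irreducible _ (fr i) u ou.
    have nr' := @cell_rep_irreducible _ (fr i') u' ou'.
    have hc := irr_pt_eq nr e.
    have hr : is_rep (val (cell_rep (fr i) u) : G -> M) by exact: set_mem (valP _).
    have c1 := cell_rep_char (fr i) u.
    have c2 := char_in_conj (conj_equiv_sym hc) (cell_rep_char (fr i') u').
    have [g eg] := irreducible_chars hr nr c1 c2.
    have hx := @disk_map_in_cell (pt _) u ou.
    have hx' := @disk_map_in_cell (pt _) u' ou'.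
    have [y ey hy] := same_cell_move (same_cell_sym hx) eg.
    (* Conjugate representations share their characters, so a motion takes the point over [p] to the
       point over [p']; carried to the reference points, it identifies the two orbits of cells. *)
    have pp' : p = p'.
      apply: pt_inj; exists g, y; split=> //.
      by apply: same_cell_sym; apply: same_cell_trans hx' hy.
    case: _ / pp' i' u' ou' e nr' hc c2 eg hx' hy => i' u' ou' e nr' hc c2 eg hx' hy.
    (* Both points now lie in one cell and differ by a motion, so rigidity makes them equal. The
       displacements then agree, and undoing the deformation makes the reference representations
       conjugate. *)
    have vv := cell_rigid (same_cell_trans (same_cell_sym hx) hx') eg.
    congr (Some (Tagged _ _)); apply: fr_inj.
    apply: (deform_inv_conj hx (f_normal _) (f_normal _)).
    by move: hc; rewrite !val_cell_rep => hc; rewrite -{2}(addrI _ vv).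
  + by have := @cell_rep_irreducible _ (fr i) u ou; case; apply/irr_pt_base.
  + by have := @cell_rep_irreducible _ (fr i') u' ou'; case; apply/irr_pt_base.
- move=> [[p i]|] u u' ou ou' /= e; last by rewrite (flatmx0 u) (flatmx0 u') || (apply/rowP => -[]).
  have nr := @cell_rep_irreducible _ (fr i) u ou.
  have hc := irr_pt_eq nr e.
  have hr : is_rep (val (cell_rep (fr i) u) : G -> M) by exact: set_mem (valP _).
  have c1 := cell_rep_char (fr i) u.
  have c2 := char_in_conj (conj_equiv_sym hc) (cell_rep_char (fr i) u').
  have [g eg] := irreducible_chars hr nr c1 c2.
  have hx := @disk_map_in_cell (pt _) u ou.
  have hx' := @disk_map_in_cell (pt _) u' ou'.
  have vv := cell_rigid (same_cell_trans (same_cell_sym hx) hx') eg.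
  have [_ _ _ inj _] := disk_mapP D (pt p).
  by apply: inj => //; apply: (@cbasis_inj _ _ _ D); exact/esym/(addrI _ vv).
- move=> [[p i]|] u bu /=; last first.
    by move: bu; rewrite /bsphere /= /sqnorm big_ord0 => /eqP; rewrite eq_sym oner_eq0.
  have [_ _ _ _ /(_ u bu)[_ [jb ejb]]] := disk_mapP D (pt p).
  have lt := facet_boundary ejb.
  have [rr|nr] := pselect (reducible (val (cell_rep (fr i) u) : G -> M)).
    exists None, 0; split; first exact: leq_ltn_trans (leq0n _) lt.
      by rewrite /odisk /= /sqnorm big_ord0; exact: ltr01.
    by apply/esym/irr_pt_base.
  have [s [w [ds ow e]]] := irreducible_covered nr (cell_rep_char (fr i) u).
  by exists (Some s), w; split=> //=; rewrite ds.
Qed.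

End Cells.

Lemma IrrPlus_CW : CW_dim_le R X k.
Proof.
have [P [pt [pt_inj pt_surj]]] := cell_orbits_finite D.
pose Q p (mf : {m & 'I_m -> framed (pt p)}) :=
  (forall i j, conj_equiv (f_rho (tagged mf i)) (f_rho (tagged mf j)) -> i = j) /\
  (forall F : framed (pt p), exists i, conj_equiv (f_rho (tagged mf i)) (f_rho F)).
have ex p : exists mf, Q p mf.
  by have [m [f hf]] := framed_finite D n (pt p); exists (existT _ m f).
pose mf p := projT1 (cid (ex p)).
have mfP p : Q p (mf p) := projT2 (cid (ex p)).
apply: (@cells_CW P pt (fun p => tag (mf p)) (fun p => tagged (mf p))) => //.
- by move=> p; exact: (mfP p).1.
- by move=> p; exact: (mfP p).2.
Qed.

End Assembly.

(** * Virtually abelian groups *)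

Lemma rV_int_ind k (P : 'rV[int]_k -> Prop) :
  P 0 -> (forall a b, P a -> P b -> P (a + b)) -> (forall a, P a -> P (- a)) ->
  (forall j, P (delta_mx 0 j)) -> forall b, P b.
Proof.
move=> P0 PD PN Pe b; rewrite (row_sum_delta b).
apply: big_ind => // j _; case: (b 0 j) => m.
  elim: m => [|m ih]; first by rewrite scale0r.
  by rewrite intS scalerDl scale1r; apply: PD.
rewrite NegzE scaleNr; apply: PN.
elim: m => [|m ih]; first by rewrite scale1r.
by rewrite intS scalerDl scale1r; apply: PD.
Qed.

(** The representative of [g] is the first element of [T] in its coset; it depends only on the
    coset, so listing the distinct representatives indexes the cosets. *)
Lemma coset_system (G : groupType) (A : G -> Prop) (T : seq G) :
  (forall a b, A a -> A b -> A (a * b)%g) -> (forall a, A a -> A a^-1%g) ->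
  (forall g, exists2 t, t \in T & A (t^-1 * g)%g) ->
  exists m (rep : 'I_m -> G) (cos : G -> 'I_m),
  [/\ forall i, cos (rep i) = i, forall g, A ((rep (cos g))^-1 * g)%g &
      forall g h, cos g = cos h <-> A (g^-1 * h)%g].
Proof.
move=> AM AV cov.
pose p g t := `[< A (t^-1 * g)%g >].
pose rep g := nth 1%g T (find (p g) T).
have hasT g : has (p g) T by have [t tT At] := cov g; apply/hasP; exists t => //; apply/asboolP.
have repP g : A ((rep g)^-1 * g)%g by have /asboolP := nth_find 1%g (hasT g).
have repT g : rep g \in T by rewrite mem_nth// -has_find.
have rep_eq g h : A (g^-1 * h)%g -> rep g = rep h.
  move=> gh; rewrite /rep; congr (nth _ _ _); apply: eq_find => t.
  apply/asboolP/asboolP => ht.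
    by have := AM _ _ ht gh; rewrite -mulgA mulVKg.
  by have := AM _ _ ht (AV _ gh); rewrite invgM invgK -mulgA mulVKg.
have rep_id g : rep (rep g) = rep g by exact: rep_eq.
pose L := undup [seq rep t | t <- T].
have repL g : rep g \in L.
  by rewrite mem_undup; apply/mapP; exists (rep g).
have cosP g : (index (rep g) L < size L)%N by rewrite index_mem.
exists (size L), (fun i => nth 1%g L i), (fun g => Ordinal (cosP g)); split.
- move=> i; apply: val_inj => /=.
  have : nth 1%g L i \in L by exact: mem_nth.
  rewrite {1}mem_undup => /mapP[t _ e]; rewrite e rep_id -e.
  by rewrite index_uniq// undup_uniq.
- by move=> g /=; rewrite nth_index.
- move=> g h; split=> [[e]|/rep_eq e]; last by apply: val_inj; rewrite /= e.
  have er : rep g = rep h by rewrite -(nth_index 1%g (repL g)) e nth_index.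
  have := AM _ _ (AV _ (repP g)) (repP h).
  by rewrite er invgM invgK -mulgA mulVKg.
Qed.

(** By induction on the rows: each earlier row is supported on its diagonal entry, which has modulus
    1, so orthogonality to it kills the corresponding entry of the next row. *)
Lemma unitary_trig_diag (R : realType) n (U : 'M[Cplx R]_n) :
  unitary U -> is_trig_mx U -> exists d, U = diag_mx d.
Proof.
move=> uU /is_trig_mxP tU; exists (\row_j U j j).
have entry i j : \sum_l U i l * Num.conj (U j l) = (i == j)%:R.
  have := congr1 (fun N : 'M[Cplx R]_n => N i j) uU; rewrite /= !mxE => <-.
  by apply: eq_bigr => l _; rewrite !mxE.
have low m : forall i j : 'I_n, (i < m)%N -> i != j -> U i j = 0.
  elim: m => // m ih i j; rewrite ltnS leq_eqVlt => /predU1P[im ij|]; last exact: ih.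
  have [lt|gt|e] := ltngtP i j; first exact: tU.
    have rowj l : l != j -> U j l = 0.
      by move=> lj; apply: ih; rewrite -?im// eq_sym.
    have jj : U j j * Num.conj (U j j) = 1.
      have := entry j j; rewrite eqxx (bigD1 j)//= big1 ?addr0// => l lj.
      by rewrite (rowj l lj) mul0r.
    have := entry i j; rewrite (negbTE ij) (bigD1 j)//= big1 ?addr0 => [/eqP|l lj].
      rewrite mulf_eq0 => /orP[/eqP//|/eqP c0].
      by move: jj; rewrite c0 mulr0 => /eqP; rewrite eq_sym oner_eq0.
    by rewrite (rowj l lj) rmorph0 mulr0.
  by move: ij; rewrite (val_inj e) eqxx.
apply/matrixP => i j; rewrite !mxE; case: eqVneq => [->|ij]; first by rewrite mulr1n.
by rewrite mulr0n (low i.+1).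
Qed.

Lemma ctrmx_diag (R : realType) n (d : 'rV[Cplx R]_n) :
  ctrmx (diag_mx d) = diag_mx (map_mx Num.conj d).
Proof.
apply/matrixP => i j; rewrite !mxE eq_sym.
by case: eqVneq => [->|_]; rewrite ?mulr1n// !mulr0n rmorph0.
Qed.

(** * Constructing a [crystal] from a finite index copy of Z^k *)

Section VirtuallyAbelian.
Variables (R : realType) (G : groupType) (k : nat) (phi : 'rV[int]_k -> G) (s : seq G).
Hypothesis phiD : forall a b, phi (a + b) = (phi a * phi b)%g.
Hypothesis phi_inj : injective phi.
Hypothesis phi_cover : forall g : G, exists2 x, x \in s & exists a, g = (x * phi a)%g.

Let H (g : G) := exists a, g = phi a.
Let A (g : G) := forall t, H (g ^ t)%g.

Lemma phi0 : phi 0 = 1%g.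
Proof. by apply: (mulIg (phi 0)); rewrite -phiD addr0 mul1g. Qed.

Lemma phiN a : phi (- a) = (phi a)^-1%g.
Proof. by apply: (mulIg (phi a)); rewrite -phiD addNr mulVg phi0. Qed.

Lemma phi_muln a m : phi (a *+ m) = (phi a ^+ m)%g.
Proof. by elim: m => [|m ih]; [rewrite mulr0n phi0|rewrite mulrS phiD ih expgS]. Qed.

Lemma H1 : H 1%g. Proof. by exists 0; rewrite phi0. Qed.
Lemma HM a b : H a -> H b -> H (a * b)%g.
Proof. by move=> [x ->] [y ->]; exists (x + y); rewrite phiD. Qed.
Lemma HV a : H a -> H a^-1%g.
Proof. by move=> [x ->]; exists (- x); rewrite phiN. Qed.
Lemma HX a m : H a -> H (a ^+ m)%g.
Proof. by move=> [x ->]; exists (x *+ m); rewrite phi_muln. Qed.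
Lemma AH a : A a -> H a. Proof. by move=> /(_ 1%g); rewrite conjg1. Qed.
Lemma A1 : A 1%g. Proof. by move=> t; rewrite conj1g; exact: H1. Qed.
Lemma AM a b : A a -> A b -> A (a * b)%g.
Proof. by move=> ha hb t; rewrite conjMg; exact: HM. Qed.
Lemma AV a : A a -> A a^-1%g.
Proof. by move=> ha t; rewrite conjVg; exact: HV. Qed.
Lemma AJ a g : A a -> A (a ^ g)%g.
Proof. by move=> ha t; rewrite -conjgM. Qed.
Lemma AC a b : A a -> A b -> (a * b = b * a)%g.
Proof. by move=> /AH[x ->] /AH[y ->]; rewrite -!phiD addrC. Qed.

(** The pigeonhole argument yields an exponent between 1 and [size s] that depends on [u]; the
    factorial is a common multiple of them all. *)
Let N := (size s)`!.

Lemma N_gt0 : (0 < N)%N. Proof. exact: fact_gt0. Qed.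

(* Pigeonhole: two of the powers [u^0, ..., u^(size s)] lie in one coset of [H]. *)
Lemma power_in_H (u : G) : H (u ^+ N)%g.
Proof.
have /choice[f hf] : forall i : nat, exists x, x \in s /\ exists a, (u ^+ i = x * phi a)%g.
  by move=> i; have [x xs ha] := phi_cover (u ^+ i)%g; exists x.
have hi i : (index (f i) s < size s)%N by rewrite index_mem (hf i).1.
pose F (i : 'I_(size s).+1) : 'I_(size s) := Ordinal (hi i).
have [i [j [ij e]]] : exists i j : 'I_(size s).+1, (i < j)%N /\ F i = F j.
  have : ~~ injectiveb F.
    by apply/negP => /injectiveP/leq_card; rewrite !card_ord ltnn.
  move=> /injectivePn[i [j ij e]].
  have [lt|lt|/val_inj eij] := ltngtP i j; last by rewrite eij eqxx in ij.
    by exists i, j.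
  by exists j, i.
have fij : f i = f j.
  have [ei] := e; rewrite -(nth_index 1%g (hf i).1) ei nth_index//; exact: (hf j).1.
have [a ea] := (hf i).2; have [b eb] := (hf j).2.
have Hm : H (u ^+ (j - i))%g.
  exists (- a + b); apply: (mulgI (u ^+ i)%g).
  by rewrite -expgnDr (subnKC (ltnW ij)) phiD phiN ea eb mulgA mulgK fij.
have /dvdnP[q ->] : (j - i %| N)%N.
  apply: dvdn_fact; rewrite subn_gt0 ij /=.
  by apply: leq_trans (leq_subr _ _) _; rewrite -ltnS.
by rewrite mulnC expgnA; exact: HX.
Qed.

(** A conjugate of an [N]-th power is the [N]-th power of a conjugate, hence lies in [H]. So the
    core contains N Z^k, which gives its finite index. *)
Lemma A_power a : A (phi (a *+ N)).
Proof. by move=> t; rewrite phi_muln conjXg; exact: power_in_H. Qed.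

Let iota (g : G) : 'rV[int]_k := xget 0 [set a | phi a = g].

Lemma iotaK g : H g -> phi (iota g) = g.
Proof. by move=> [a ->]; rewrite /iota; apply: (@xgetPex _ 0 [set b | phi b = phi a]);
exists a. Qed.

Lemma phiK a : iota (phi a) = a.
Proof. by apply: phi_inj; apply: iotaK; exists a. Qed.

Lemma iotaM a b : H a -> H b -> iota (a * b)%g = iota a + iota b.
Proof.
by move=> ha hb; apply: phi_inj; rewrite phiD !iotaK//; exact: HM.
Qed.

Let wv (b : 'rV[int]_k) : 'cV[R]_k := \col_i (b 0 i)%:~R.

Lemma wvD a b : wv (a + b) = wv a + wv b.
Proof. by apply/colP => i; rewrite !mxE intrD. Qed.
Lemma wv0 : wv 0 = 0.
Proof. by apply/colP => i; rewrite !mxE. Qed.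
Lemma wvN a : wv (- a) = - wv a.
Proof. by apply/colP => i; rewrite !mxE intrN. Qed.
Lemma wvMn a m : wv (a *+ m) = wv a *+ m.
Proof. by elim: m => [|m ih]; [rewrite wv0|rewrite !mulrS wvD ih]. Qed.

Let w g := wv (iota g).

Lemma wM a b : A a -> A b -> w (a * b)%g = w a + w b.
Proof. by move=> /AH ha /AH hb; rewrite /w iotaM// wvD. Qed.

Lemma wX a m : A a -> w (a ^+ m)%g = w a *+ m.
Proof.
move=> /AH ha; rewrite /w -wvMn; congr wv; apply: phi_inj.
by rewrite phi_muln !iotaK//; exact: HX.
Qed.

(** Conjugation by [g] need not preserve [H], so basis vectors cannot be conjugated directly; their
    [N]-th multiples lie in [A], and the result is divided by [N]. *)
Let bmx g : 'M[R]_k :=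
  \matrix_(i, j) (N%:R^-1 * w (phi (delta_mx 0 j *+ N) ^ g)%g i 0).

Lemma bmx_wv g b : bmx g *m wv b = N%:R^-1 *: w (phi (b *+ N) ^ g)%g.
Proof.
have AN c : A (phi (c *+ N) ^ g)%g by apply: AJ; exact: A_power.
elim/rV_int_ind: b => [|a b ha hb|a ha|j].
- by rewrite wv0 mulmx0 mul0rn phi0 conj1g -phi0 /w phiK wv0 scaler0.
- by rewrite wvD mulmxDr ha hb mulrnDl phiD conjMg (wM (AN a) (AN b)) scalerDr.
- rewrite wvN mulmxN ha mulNrn phiN conjVg -scalerN; congr (_ *: _).
  apply/esym/eqP; rewrite -addr_eq0 -(wM (AV (AN a)) (AN a)) mulVg.
  by rewrite -phi0 /w phiK wv0.
- apply/colP => i; rewrite mxE [RHS]mxE (bigD1 j)//= big1 ?addr0 => [|l lj].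
    by rewrite !mxE !eqxx mulr1.
  by rewrite !mxE (negbTE lj) andbF mulr0.
Qed.

Lemma N_neq0 : N%:R != 0 :> R.
Proof. by rewrite pnatr_eq0 -lt0n N_gt0. Qed.

Lemma bmx_w a g : A a -> bmx g *m w a = w (a ^ g)%g.
Proof.
move=> Aa; rewrite /w bmx_wv phi_muln iotaK; last exact: AH.
rewrite conjXg wX; last exact: AJ.
by rewrite -[X in _ *: X]scaler_nat scalerA mulVf ?scale1r// N_neq0.
Qed.

Let residues : seq 'rV[int]_k := [seq \row_j Posz (f j) | f : {ffun 'I_k -> 'I_N}].

Lemma residue_decomp (a : 'rV[int]_k) : exists2 r, r \in residues & exists b, a = r + b *+ N.
Proof.
have Np : 0 < N%:Z by rewrite ltz_nat N_gt0.
have N0 : N%:Z != 0 by rewrite gt_eqF.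
have hr j : (absz (modz (a 0%R j) N%:Z) < N)%N.
  by rewrite -ltz_nat gez0_abs ?modz_ge0// ltz_pmod.
exists (\row_j Posz (absz (modz (a 0%R j) N%:Z))).
  apply/mapP; exists [ffun j => Ordinal (hr j)]; first by rewrite mem_enum.
  by apply/rowP => j; rewrite !mxE ffunE.
exists (\row_j divz (a 0%R j) N%:Z); apply/rowP => j.
rewrite !mxE mulmxnE !mxE gez0_abs; last by rewrite modz_ge0.
by rewrite {1}(divz_eq (a 0 j) N%:Z) addrC -mulr_natr natz.
Qed.

Lemma A_cover g : exists2 t, t \in [seq (x * phi r)%g | x <- s, r <- residues] & A (t^-1 * g)%g.
Proof.
have [x xs [a ->]] := phi_cover g; have [r rr [b ->]] := residue_decomp a.
exists (x * phi r)%g; first by apply/allpairsP; exists (x, r).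
by rewrite invgM phiD mulgA -!mulgA mulKg mulKg; exact: A_power.
Qed.

Lemma pr_phi (x : 'rV[R]_k) b : (x *m wv b) 0 0 = \sum_j x 0 j * (b 0 j)%:~R.
Proof. by rewrite mxE; apply: eq_bigr => j _; rewrite mxE. Qed.

(** The images of the generators are commuting unitary matrices, so they are simultaneously
    triangular in a unitary basis, hence diagonal. Logarithms of their entries are the coordinates
    of the [x j], and additivity extends the formula to all of Z^k. *)
Lemma diagonalise n (rho : G -> 'M[Cplx R]_n) : is_rep rho ->
  exists (U : 'M[Cplx R]_n) (x : 'I_n -> 'rV[R]_k), unitary U /\
  forall a, A a -> U *m rho a *m ctrmx U = diag_mx (\row_j expi ((x j *m w a) 0 0)).
Proof.
move=> hr.
pose As := [seq rho (phi (delta_mx 0 j)) | j : 'I_k].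
have As_comm : {in As &, forall B C, comm_mx B C}.
  move=> _ _ /mapP[i _ ->] /mapP[j _ ->].
  by rewrite /comm_mx -!hr.2 -!phiD addrC.
have [U uU /allP hU] := cotrigonalization As_comm.
have uU' : unitary U by apply/unitaryP.
pose sigma g := U *m rho g *m ctrmx U.
have hs : is_rep sigma by apply: conj_rep hr; exists U.
have ex j : exists y : 'I_n -> R, sigma (phi (delta_mx 0 j)) = diag_mx (\row_l expi (y l)).
  have : is_trig_mx (sigma (phi (delta_mx 0 j))).
    have /hU : rho (phi (delta_mx 0 j)) \in As by apply/mapP; exists j => //; rewrite mem_enum.
    by rewrite /similar_to inE (conjymx _ uU) -ctrmxE.
  move=> /(unitary_trig_diag (hs.1 _))[d dE].
  have hd l : d 0 l * Num.conj (d 0 l) = 1.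
    have := hs.1 (phi (delta_mx 0 j)); rewrite /unitary dE.
    move=> /(congr1 (fun N : 'M[Cplx R]_n => N l l)); rewrite /= diag_mulmxE !mxE eqxx.
    by rewrite !mulr1n.
  have /choice[y hy] : forall l, exists t, d 0 l = expi t by move=> l; exact: expi_surj.
  by exists y; rewrite dE; congr diag_mx; apply/rowP => l; rewrite mxE hy.
have [y hy] := choice ex.
pose x l : 'rV[R]_k := \row_j y j l.
exists U, x; split=> // a /AH/iotaK <-; rewrite -/(sigma _) /w phiK.
elim/rV_int_ind: (iota a) => [|b c hb hc|b hb|j].
- rewrite phi0 (rep1 hs) wv0 -diag_const_mx; congr diag_mx; apply/rowP => l.
  by rewrite [LHS]mxE [RHS]mxE mulmx0 mxE expi0.
- rewrite phiD hs.2 hb hc mulmx_diag; congr diag_mx; apply/rowP => l.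
  rewrite [RHS]mxE wvD mulmxDr [X in expi X]mxE expiD [LHS]mxE.
  by rewrite [X in X * _ = _]mxE [X in _ * X = _]mxE.
- rewrite phiN (repV _ hs) hb ctrmx_diag; congr diag_mx; apply/rowP => l.
  by rewrite mxE [X in Num.conj X]mxE -expiN [RHS]mxE wvN mulmxN [X in _ = expi X]mxE.
- rewrite hy; congr diag_mx; apply/rowP => l; rewrite [LHS]mxE [RHS]mxE pr_phi.
  rewrite (bigD1 j)//= big1 ?addr0 => [|i ij]; last by rewrite !mxE (negbTE ij) mulr0.
  by rewrite !mxE !eqxx mulr1.
Qed.

Lemma crystal_of_virtually_Zk : exists D : crystal R G k, True.
Proof.
have [m [rep [cos [repK repP cosP]]]] := coset_system AM AV A_cover.
pose S0 := 1%g :: [seq phi (delta_mx 0 j *+ N) | j : 'I_k].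
have S0A t : t \in S0 -> A t.
  by rewrite inE => /predU1P[->|/mapP[j _ ->]]; [exact: A1|exact: A_power].
(* Conjugation on [A] factors through the cosets since [A] is abelian, so conjugating by
   representatives already gives a stable set. *)
pose S := [seq (t ^ rep q)%g | t <- S0, q <- enum 'I_m].
have conjA a t : A a -> A t -> (t ^ a)%g = t.
  by move=> Aa At; rewrite /conjg (AC At Aa) mulKg.
have inS t g : t \in S0 -> (t ^ g)%g \in S.
  move=> tS; apply/allpairsP; exists (t, cos g); split=> //=; first by rewrite mem_enum.
  have Ag := repP g.
  set r := rep (cos g) in Ag *.
  (* Normality moves the factor from [A] to the left of the coset representative, where it
     conjugates [t] trivially. *)
  have gE : g = (((r^-1 * g) ^ r^-1) * r)%g by rewrite /conjg invgK mulgA mulVKg mulgVK.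
  by rewrite [in LHS]gE conjgM (conjA _ _ (AJ _ Ag) (S0A _ tS)).
have S0S t : t \in S0 -> t \in S by move=> /(inS _ 1%g); rewrite conjg1.
have SA t : t \in S -> A t.
  by move=> /allpairsP[[u q] [/= uS _ ->]]; apply: AJ; exact: S0A.
have prN j (x : 'rV[R]_k) : (x *m w (phi (delta_mx 0 j *+ N))) 0 0 = x 0 j * N%:R.
  rewrite /w phiK wvMn -[wv _ *+ _]scaler_nat -scalemxAr mxE pr_phi mulrC; congr (_ * _).
  rewrite (bigD1 j)//= big1 ?addr0 => [|i ij]; last by rewrite !mxE (negbTE ij) mulr0.
  by rewrite !mxE !eqxx mulr1.
have eS j : phi (delta_mx 0 j *+ N) \in S.
  by apply: S0S; rewrite inE; apply/orP; right; apply/mapP; exists j => //; rewrite mem_enum.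
unshelve refine (ex_intro _ (@Crystal R G k A w bmx m rep cos S
  A1 AM AV AJ AC wM (fun a g => @bmx_w a g)
  repK repP cosP SA _ _ _ _ diagonalise) I).
- by apply: S0S; rewrite inE eqxx.
- by move=> t g /allpairsP[[u q] [/= uS _ ->]]; rewrite -conjgM; exact: inS.
- move=> x hx; apply/rowP => j; have := hx _ (eS j); rewrite prN mxE => /eqP.
  by rewrite mulf_eq0 (negbTE N_neq0) orbF => /eqP.
- exists (\sum_(t <- S) \sum_j absz (iota t 0%R j))%N => x.
  exists (\row_j (Num.floor (x 0 j))%:~R).
    move=> a Aa; rewrite /w pr_phi; apply: rpred_sum => j _.
    by rewrite mxE rpredM// rpred_int.
  move=> t tS; rewrite /w pr_phi.
  apply: (@le_trans _ _ (\sum_j absz (iota t 0%R j))%N%:R); last first.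
    by rewrite ler_nat (big_rem t)//= leq_addr.
  apply: le_trans (ler_norm_sum _ _ _) _; rewrite natr_sum; apply: ler_sum => j _.
  rewrite normrM !mxE natr_absz intr_norm ler_piMl//.
  rewrite ger0_norm ?subr_ge0 ?ge_floor// lerBlDl ltW//.
  by rewrite -[X in _ < _ + X]/(1%:~R) -intrD lt_succ_floor.
Qed.

End VirtuallyAbelian.

Theorem theorem1p3 (R : realType) (G : groupType) (k n : nat) :
  virtually_Zk G k -> (0 < n)%N ->
  exists Y : topologicalType, homeomorphic (IrrPlus R G n) Y /\ CW_dim_le R Y k.
Proof.
move=> [phi [phiD [phi_inj [s phi_cover]]]] n0.
have [D _] := crystal_of_virtually_Zk R phiD phi_inj phi_cover.
exists (IrrPlus R G n); split; last exact: IrrPlus_CW D n0.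
by exists id, id; split=> // x U.
Qed.
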